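(* Let $(M,\eta,\xi,\phi,g)$ be a 3-dimensional contact metric manifold. Then $M$ is a $\phi$-recurrent $N(k)$-contact metric manifold (for some real constant $k$) if and only if the Riemannian manifold $(M,g)$ is flat.
   Context: Manifolds are smooth and non-empty. A contact metric manifold is a $(2n+1)$-dimensional manifold $M$, $n\ge 1$, with a 1-form $\eta$ satisfying $\eta\wedge(d\eta)^n\neq 0$ everywhere, the characteristic vector field $\xi$ (determined by $\eta(\xi)=1$, $d\eta(\xi,\cdot)=0$), a Riemannian metric $g$ and a $(1,1)$-tensor field $\phi$ such that for all vector fields $X,Y$: $\eta(X)=g(X,\xi)$, $d\eta(X,Y)=g(X,\phi Y)$, $\phi^2X=-X+\eta(X)\xi$. Convention: $d\eta(X,Y)=\frac12\big(X\eta(Y)-Y\eta(X)-\eta([X,Y])\big)$. Let $\nabla$ be the Levi-Civita connection of $g$ and $R(X,Y)Z=\nabla_X\nabla_YZ-\nabla_Y\nabla_XZ-\nabla_{[X,Y]}Z$. The contact metric manifold is an $N(k)$-contact metric manifold, for a real constant $k$, if $R(X,Y)\xi=k[\eta(Y)X-\eta(X)Y]$ for all vector fields $X,Y$. It is $\phi$-recurrent if there exists a non-zero 1-form $A$ (i.e. not identically zero) such that $\phi^2((\nabla_WR)(X,Y)Z)=A(W)R(X,Y)Z$ for all vector fields $X,Y,Z,W$ (not necessarily orthogonal to $\xi$). Flat means $R=0$. *)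

(* Defs.v *)
From HB Require Import structures.
From mathcomp Require Import all_boot all_order all_algebra.
From mathcomp Require Import perm.
From mathcomp Require Import all_classical all_reals.
From mathcomp Require Import topology normedtype derive.

Set Implicit Arguments.
Unset Strict Implicit.
Unset Printing Implicit Defensive.

Import Order.TTheory GRing.Theory Num.Theory.
Import numFieldNormedType.Exports.

Local Open Scope classical_set_scope.
Local Open Scope ring_scope.

Section EuclideanSmooth.
Context {R : realType} {d : nat}.
Implicit Types (U : set 'rV[R]_d) (f g : 'rV[R]_d -> R).

(* Meaningful for U open: the total function 'D_v f x only depends on the
   germ of f at x. *)
Fixpoint Ck (k : nat) U f : Prop :=
  (forall x, U x -> {for x, continuous f}) /\
  match k with
  | 0 => True
  | k'.+1 => forall i : 'I_d,
      (forall x, U x -> derivable f x (delta_mx 0 i)) /\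
      Ck k' U ('D_(delta_mx 0 i) f)
  end.

Definition smooth_on U f := forall k, Ck k U f.

Lemma CkS k U f : Ck k.+1 U f -> Ck k U f.
Proof.
elim: k f => [|k IH] f [cf df]; first by split.
by split=> // i; have [dfi /IH] := df i; split.
Qed.

Lemma Ck_ext k U f g : open U -> {in U, f =1 g} -> Ck k U f -> Ck k U g.
Proof.
move=> oU.
have near_eq (f1 f2 : 'rV[R]_d -> R) x : {in U, f1 =1 f2} -> U x ->
    \forall y \near x, f1 y = f2 y.
  move=> eq12 Ux; have Un : nbhs x U by exact: open_nbhs_nbhs.
  by near=> y; apply: eq12; rewrite inE; near: y.
have continuous_eq (f1 f2 : 'rV[R]_d -> R) : {in U, f1 =1 f2} ->
    (forall x, U x -> {for x, continuous f1}) ->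
    forall x, U x -> {for x, continuous f2}.
  move=> eq12 cf x Ux; rewrite /prop_for /continuous_at -(eq12 x) ?inE//.
  apply: cvg_trans (cf x Ux).
  exact: (near_eq_cvg (F := nbhs x) (near_eq _ _ _ eq12 Ux)).
elim: k f g => [|k IH] f g fg [cf df]; split=> //; try exact: continuous_eq cf.
move=> i; have [dfi Cfi] := df i; split.
  by move=> x Ux; apply: near_eq_derivable (dfi x Ux); exact: near_eq.
apply: IH Cfi => x; rewrite inE => Ux.
by apply: near_eq_derive; exact: near_eq.
Unshelve. all: by end_near. Qed.

Lemma Ck_cst k U (c : R) : Ck k U (fun=> c).
Proof.
elim: k c => [|k IH] c; (split; first by move=> x _; exact: cst_continuous).
  by [].
move=> i; split=> [x _|]; first exact: derivable_cst.
rewrite (_ : 'D_(delta_mx 0 i) _ = fun=> 0); first exact: IH.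
by apply/funext => x; exact: derive_cst.
Qed.

Lemma Ck_add k U f g : open U -> Ck k U f -> Ck k U g -> Ck k U (f + g).
Proof.
move=> oU; elim: k f g => [|k IH] f g [cf df] [cg dg].
all: have cfg x : U x -> {for x, continuous (f + g)}
  by move=> Ux; exact: continuousD (cf x Ux) (cg x Ux).
  by split.
split=> // i; have [dfi Cfi] := df i; have [dgi Cgi] := dg i; split.
  by move=> x Ux; apply: derivableD; [exact: dfi|exact: dgi].
apply: (Ck_ext oU _ (IH _ _ Cfi Cgi)) => x; rewrite inE => Ux.
by rewrite deriveD//; [exact: dfi|exact: dgi].
Qed.

Lemma Ck_mul k U f g : open U -> Ck k U f -> Ck k U g -> Ck k U (f * g).
Proof.
move=> oU; elim: k f g => [|k IH] f g Cf Cg; have [cf df] := Cf;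
  have [cg dg] := Cg.
all: have cfg x : U x -> {for x, continuous (f * g)}
  by move=> Ux; exact: continuousM (cf x Ux) (cg x Ux).
  by split.
split=> // i; have [dfi Cfi] := df i; have [dgi Cgi] := dg i; split.
  by move=> x Ux; apply: derivableM; [exact: dfi|exact: dgi].
have C1 := Ck_add oU (IH _ _ (CkS Cf) Cgi) (IH _ _ (CkS Cg) Cfi).
apply: (Ck_ext oU _ C1) => x; rewrite inE => Ux.
by rewrite deriveM//; [exact: dfi|exact: dgi].
Qed.

End EuclideanSmooth.

(* A chart is a partial map, represented by total functions whose values
   outside chart_dom, resp. chart_codom, are irrelevant. *)
Record chart (R : realType) (d : nat) (T : topologicalType) := Chart {
  chart_dom : set T;
  chart_map :> T -> 'rV[R]_d;
  chart_inv : 'rV[R]_d -> T;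
  chart_codom := chart_map @` chart_dom;
  chart_dom_open : open chart_dom;
  chart_codom_open : open chart_codom;
  chart_mapK : {in chart_dom, cancel chart_map chart_inv};
  chart_map_continuous : {within chart_dom, continuous chart_map};
  chart_inv_continuous : {within chart_codom, continuous chart_inv}
}.

Definition compatible (R : realType) d (T : topologicalType)
    (c1 c2 : chart R d T) :=
  forall i : 'I_d, smooth_on (c1 @` (chart_dom c1 `&` chart_dom c2))
    (fun y => c2 (chart_inv c1 y) 0 i).

Record manifold (R : realType) (d : nat) := Manifold {
  carrier :> topologicalType;
  atlas : set (chart R d carrier);
  manifold_hausdorff : hausdorff_space carrier;
  manifold_second_countable : @second_countable carrier;
  manifold_nonempty : inhabited carrier;
  atlas_cover : forall p : carrier, exists2 c, atlas c & chart_dom c p;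
  atlas_compatible : forall c1 c2, atlas c1 -> atlas c2 -> compatible c1 c2
}.

Section SmoothFunctions.
Context {R : realType} {d : nat} {M : manifold R d}.

Definition smooth (f : M -> R) :=
  forall c, atlas c -> smooth_on (chart_codom c) (f \o chart_inv c).

Definition smooth_pred : {pred M -> R} := fun f => `[< smooth f >].

Lemma smooth_cst (a : R) : smooth (cst a).
Proof. by move=> c _ k; exact: Ck_cst. Qed.

Lemma smooth_subring_closed : subring_closed smooth_pred.
Proof.
split=> [|f g|f g]; first exact/asboolP/smooth_cst.
  move=> /asboolP sf /asboolP sg; apply/asboolP => c Ac k.
  have oc := @chart_codom_open _ _ _ c.
  have := Ck_add oc (sf c Ac k)
    (Ck_mul oc (Ck_cst k _ (-1)) (sg c Ac k)).
  by apply: Ck_ext => // x _ /=; rewrite !fctE /= mulN1r.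
move=> /asboolP sf /asboolP sg; apply/asboolP => c Ac k.
exact: (Ck_mul (@chart_codom_open _ _ _ c) (sf c Ac k) (sg c Ac k)).
Qed.

End SmoothFunctions.

Section FunctionAlgebra.
Context {R : realType} {d : nat} (M : manifold R d).

Record Cinfty := CinftyOf {
  Cinfty_fun :> M -> R;
  Cinfty_smooth : Cinfty_fun \in smooth_pred
}.

HB.instance Definition _ := [isSub for Cinfty_fun].
HB.instance Definition _ := [Choice of Cinfty by <:].
HB.instance Definition _ := GRing.SubChoice_isSubComPzRing.Build
  (M -> R) smooth_pred Cinfty smooth_subring_closed.

Definition cstC (a : R) : Cinfty :=
  CinftyOf (introT (asboolP _) (smooth_cst a)).

(* Vector fields are the derivations of the real algebra C^oo(M). *)
Definition derivation (D : Cinfty -> Cinfty) :=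
  (forall (a : R) (f g : Cinfty), D (cstC a * f + g) = cstC a * D f + D g) /\
  (forall f g : Cinfty, D (f * g) = D f * g + f * D g).

Definition derivation_pred : {pred Cinfty -> Cinfty^o} :=
  fun D => `[< derivation D >].

Lemma derivation_submod_closed : submod_closed derivation_pred.
Proof.
split=> [|h X Y /asboolP[XL XM] /asboolP[YL YM]]; apply/asboolP.
  have zero_fct f : (0 : Cinfty -> Cinfty^o) f = 0 :> Cinfty by [].
  by split=> *; rewrite !zero_fct ?mulr0 ?mul0r addr0.
have lin_fct f : (h *: X + Y) f = h * X f + Y f :> Cinfty by [].
split=> [a f g|f g]; rewrite !lin_fct ?XL ?YL ?XM ?YM.
  by rewrite !mulrDr addrACA [h * (_ * _)]mulrCA.
by rewrite mulrDl !mulrDr addrACA [h * (f * _)]mulrCA [h * (X f * g)]mulrA.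
Qed.

Record vfield := VField {
  vfield_fun :> Cinfty -> Cinfty^o;
  vfield_der : vfield_fun \in derivation_pred
}.

HB.instance Definition _ := [isSub for vfield_fun].
HB.instance Definition _ := [Choice of vfield by <:].
HB.instance Definition _ := GRing.SubChoice_isSubLmodule.Build Cinfty
  (Cinfty -> Cinfty^o) derivation_pred vfield
  (GRing.submod_closed_semi derivation_submod_closed).

Lemma bracket_subproof (X Y : vfield) :
  (fun f => X (Y f) - Y (X f)) \in derivation_pred.
Proof.
have /asboolP[XL XM] := vfield_der X; have /asboolP[YL YM] := vfield_der Y.
have addD (Z : vfield) f g : Z (f + g) = Z f + Z g :> Cinfty.
  have /asboolP[ZL _] := vfield_der Z.
  have := ZL 1 f g; rewrite (_ : cstC 1 = 1); last exact/val_inj.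
  by rewrite !mul1r.
apply/asboolP; split=> [a f g|f g].
  by rewrite YL XL XL YL opprD addrACA -mulrBr.
rewrite YM XM !addD !XM !YM !opprD.
rewrite mulrBl mulrBr !addrA [LHS](ACl (1*5*4*8*(2*7)*(3*6)))/=.
by rewrite !subrr !addr0.
Qed.

Definition bracket (X Y : vfield) : vfield := VField (bracket_subproof X Y).

End FunctionAlgebra.

(* Tensor fields are C^oo(M)-multilinear maps on the C^oo(M)-module of vector
   fields: 1-forms have type {scalar vfield M}, (1,1)-tensor fields have type
   {linear vfield M -> vfield M}. *)
Section Geometry.
Context {R : realType} {d : nat} {M : manifold R d}.
Implicit Types (X Y Z W : vfield M) (f : Cinfty M) (p : M).
Implicit Types (g : vfield M -> vfield M -> Cinfty M).
Implicit Types (nabla : vfield M -> vfield M -> vfield M).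

(* The tangent vector of X at p is the point derivation f |-> (X f)(p). *)
Definition tangent X p : Cinfty M -> R := fun f => (X f : Cinfty M) p.

Record riemannian_metric g : Prop := {
  metric_linear : forall f X Y Z, g (f *: X + Y) Z = f * g X Z + g Y Z;
  metric_sym : forall X Y, g X Y = g Y X;
  metric_pos : forall X p, tangent X p <> cst 0 -> 0 < g X X p
}.

Record levi_civita g nabla : Prop := {
  nabla_linear : forall f X Y Z,
    nabla (f *: X + Y) Z = f *: nabla X Z + nabla Y Z;
  nabla_add : forall X Y Z, nabla X (Y + Z) = nabla X Y + nabla X Z;
  nabla_leibniz : forall f X Y,
    nabla X (f *: Y) = X f *: Y + f *: nabla X Y;
  nabla_torsion_free : forall X Y, nabla X Y - nabla Y X = bracket X Y;
  nabla_metric : forall X Y Z,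
    X (g Y Z) = g (nabla X Y) Z + g Y (nabla X Z)
}.

Definition curvature nabla X Y Z : vfield M :=
  nabla X (nabla Y Z) - nabla Y (nabla X Z) - nabla (bracket X Y) Z.

(* (nabla_W R)(X, Y)Z, by the Leibniz rule for the covariant derivative of
   tensor fields. *)
Definition nabla_curvature nabla W X Y Z : vfield M :=
  nabla W (curvature nabla X Y Z)
  - curvature nabla (nabla W X) Y Z
  - curvature nabla X (nabla W Y) Z
  - curvature nabla X Y (nabla W Z).

Definition flat nabla := forall X Y Z, curvature nabla X Y Z = 0.

Definition ext_deriv (eta : {scalar vfield M}) X Y : Cinfty M :=
  cstC M 2^-1 * (X (eta Y) - Y (eta X) - eta (bracket X Y)).

Definition N_contact (k : R) (eta : {scalar vfield M}) (xi : vfield M)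
    nabla := forall X Y,
  curvature nabla X Y xi = cstC M k *: (eta Y *: X - eta X *: Y).

(* The 1-form A is only required not to vanish identically. *)
Definition phi_recurrent (phi : {linear vfield M -> vfield M}) nabla :=
  exists2 A : {scalar vfield M}, (exists W, A W <> 0) &
    forall W X Y Z, phi (phi (nabla_curvature nabla W X Y Z)) =
                    A W *: curvature nabla X Y Z.

End Geometry.

Section Contact.
Context {R : realType} {n : nat} {M : manifold R n.*2.+1}.
Implicit Types (X Y : vfield M) (p : M).
Implicit Types (eta : {scalar vfield M}) (xi : vfield M).
Implicit Types (g : vfield M -> vfield M -> Cinfty M).
Implicit Types (phi : {linear vfield M -> vfield M}).

(* eta /\ (d eta)^n evaluated on X_0, ..., X_2n, up to the positive
   normalisation constant of the wedge product. *)
Definition contact_volume eta (Xs : 'I_n.*2.+1 -> vfield M) : Cinfty M :=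
  \sum_(s : 'S_n.*2.+1) (-1) ^+ s *
    (eta (Xs (s ord0)) *
     \prod_(i < n) ext_deriv eta (Xs (s (inord i.*2.+1)))
                                 (Xs (s (inord i.*2.+2)))).

Record contact_metric eta xi g phi : Prop := {
  contact_nondeg : forall p, exists Xs, contact_volume eta Xs p != 0;
  contact_xi : eta xi = 1;
  contact_reeb : forall X, ext_deriv eta xi X = 0;
  contact_riemannian : riemannian_metric g;
  contact_eta : forall X, eta X = g X xi;
  contact_deta : forall X Y, ext_deriv eta X Y = g X (phi Y);
  contact_phi2 : forall X, phi (phi X) = - X + eta X *: xi
}.

End Contact.

(* Main.v *)
(* A flat contact metric manifold is phi-recurrent with k = 0 and A = eta.
   Conversely, phi^2 kills the component along xi, so phi-recurrence forces
   A(W) eta(R(X,Y)Z) = 0; in an N(k)-manifold this is k times a tensor that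
   vanishes nowhere, hence k = 0, i.e. R(X,Y) xi = 0.  Put B X := nabla_X xi;
   its skew part is - phi.  The equation R(xi,X) xi = 0 reads
   nabla_xi B = - B^2; in dimension 3 its skew part gives tr B = 0 and then its
   trace gives B^2 = 0, so B has rank one, with kernel on ker eta spanned by
   some E.  Then R(E, phi E) xi = 0 and R(xi, E) xi = 0 say that
   g(nabla_Z E, phi E) = 0 for all Z, whence g(R(U,V)E, phi E) = 0 and R = 0.

   Frames are global vector fields that are only usable where their squared
   norm rho does not vanish.  Dimension 3 enters through the fact that, near
   each point, the derivations of C^oo(M) are generated by three of them: this
   is Hadamard's lemma in a chart together with a smooth bump function. *)

From HB Require Import structures.
Require Import Defs.
From mathcomp Require Import all_boot all_order all_algebra.
From mathcomp Require Import all_classical all_reals all_analysis.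
From mathcomp Require Import ring lra.

Set Implicit Arguments.
Unset Strict Implicit.
Unset Printing Implicit Defensive.

Import Order.TTheory GRing.Theory Num.Theory.
Import numFieldNormedType.Exports.

Local Open Scope classical_set_scope.
Local Open Scope ring_scope.


(** * Chain rule for functions of class C^k *)

Section ChainRule.
Context {R : realType}.

(** One statement covers both signs of [a] and [a = 0], since [a] will be a coordinate of a
    displacement. *)
Lemma MVT_from0 (f df : R -> R) (a : R) :
  (forall t : R, `|t| <= `|a| -> is_derive t 1 f (df t)) ->
  exists2 t, `|t| <= `|a| & f a - f 0 = df t * a.
Proof.
move=> fdf.
have cf (b c : R) : `|b| <= `|a| -> `|c| <= `|a| -> {within `[b, c], continuous f}.
  move=> ba ca; apply: derivable_within_continuous => t.
  rewrite in_itv/= => /andP[bt tc]; have [] := fdf t => //.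
  rewrite ler_norml; apply/andP; split.
    by apply: le_trans bt; move: ba; rewrite ler_norml => /andP[].
  by apply: (le_trans tc); move: ca; rewrite ler_norml => /andP[].
have [a0|a0|->] := ltgtP a 0.
- have [t|| t tI E] := @MVT R f df a 0 a0.
  + rewrite in_itv/= => /andP[at_ t0]; apply: fdf.
    by rewrite ltr0_norm// ltr0_norm// lerN2 ltW.
  + by apply: cf; rewrite ?normr0.
  exists t; last by rewrite -opprB E sub0r mulrN opprK.
  move: tI; rewrite in_itv/= => /andP[at_ t0].
  by rewrite ltr0_norm// ltr0_norm// lerN2 ltW.
- have [t|| t tI E] := @MVT R f df 0 a a0.
  + rewrite in_itv/= => /andP[at_ t0]; apply: fdf.
    by rewrite gtr0_norm// gtr0_norm// ltW.
  + by apply: cf; rewrite ?normr0.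
  exists t; last by rewrite E subr0.
  move: tI; rewrite in_itv/= => /andP[at_ t0].
  by rewrite gtr0_norm// gtr0_norm// ltW.
- by exists 0 => //; rewrite subrr mulr0.
Qed.

Lemma is_derive_line (V W : normedModType R) (f : V -> W) (x v : V) (t : R) :
  derivable f (t *: v + x) v ->
  is_derive t 1 (fun s : R => f (s *: v + x)) ('D_v f (t *: v + x)).
Proof.
move=> dfx.
have E : (fun h : R => h^-1 *: (f (h *: v + (t *: v + x)) - f (t *: v + x)))
  = (fun h : R => h^-1 *: (f ((h *: (1 : R^o) + t) *: v + x) - f (t *: v + x))).
  by apply/funext => h; rewrite addrA -scalerDl [h *: _]mulr1.
by split; [move: dfx; rewrite /derivable E | rewrite /derive E].
Qed.

Lemma differentiable_intro (V W : normedModType R) (f : V -> W)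
    (df : {linear V -> W}) (x : V) : continuous df ->
  (forall e : R, 0 < e -> exists2 r : R, 0 < r &
    forall h, `|h| < r -> `|f (h + x) - (f x + df h)| <= e * `|h|) ->
  differentiable f x.
Proof.
move=> cdf small; suff key : f \o shift x = cst (f x) + df +o_ 0 id.
  by apply/diff_locallyP; rewrite (diff_unique cdf key).
apply/eqaddoP => e /small[r r0 rP]; apply/nbhs_normP; exists r => // h /=.
by rewrite /ball_/= sub0r normrN => /rP.
Qed.

Context {d : nat}.
Implicit Types (f : 'rV[R]_d -> R) (x v : 'rV[R]_d).

(** The path from [x] to [v + x] changes one coordinate at a time, and the one-variable mean value
    theorem applies to each edge. In the sup norm the whole path stays within [|v|] of [x]. *)
Lemma rV_MVT f x v :
  (forall y, `|y - x| <= `|v| -> forall i, derivable f y (delta_mx 0 i)) ->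
  exists2 xi : 'I_d -> 'rV[R]_d, forall i, `|xi i - x| <= `|v| &
    f (v + x) - f x = \sum_i 'D_(delta_mx 0 i) f (xi i) * v 0 i.
Proof.
move=> dfx.
(* [z k] has the first [k] coordinates of [v + x] and the remaining ones of [x]. *)
pose z (k : nat) : 'rV[R]_d := \row_i (if (i < k)%N then v 0 i + x 0 i else x 0 i).
have zS (k : 'I_d) : z k.+1 = v 0 k *: delta_mx 0 k + z k.
  apply/rowP => i; rewrite !mxE eqxx/= ltnS leq_eqVlt -val_eqE/=.
  by case: eqVneq => [/val_inj->|_]/=; rewrite ?ltnn ?mulr1// mulr0 add0r.
have near_z (k : 'I_d) (t : R) : `|t| <= `|v 0 k| ->
    `|t *: delta_mx 0 k + z k - x| <= `|v|.
  move=> tk; rewrite [leLHS]mx_normrE; apply/bigmax_leP; split => //= -[a b] _.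
  rewrite ord1 /= !mxE eqxx/=.
  have vle : forall j, `|v 0 j| <= `|v|.
    by move=> j; rewrite [leRHS]mx_normrE; exact: (le_bigmax _ _ (0, j)).
  have [->|bk] := eqVneq b k; first by rewrite ltnn mulr1 addrK (le_trans tk).
  by rewrite mulr0 add0r; case: ifP => _; rewrite ?addrK// subrr normr0.
have step (k : 'I_d) : exists2 y, `|y - x| <= `|v| &
    f (z k.+1) - f (z k) = 'D_(delta_mx 0 k) f y * v 0 k.
  have [t tk E] := @MVT_from0 (fun s : R => f (s *: delta_mx 0 k + z k))
    (fun s => 'D_(delta_mx 0 k) f (s *: delta_mx 0 k + z k)) (v 0 k)
    (fun s sk => is_derive_line (dfx _ (near_z _ _ sk) k)).
  by exists (t *: delta_mx 0 k + z k); [exact: near_z | rewrite zS -E scale0r add0r].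
have [xi xiP] := choice (fun k => (exists2P _ _).1 (step k)).
exists xi => [i|]; first by have [] := xiP i.
have -> : v + x = z d by apply/rowP => i; rewrite !mxE ltn_ord.
have -> : f x = f (z 0%N) by congr f; apply/rowP => i; rewrite !mxE.
rewrite -(telescope_sumr (f \o z))// big_mkord; apply: eq_bigr => i _.
by have [] := xiP i.
Qed.

Lemma C1_differentiable (U : set 'rV[R]_d) f x : open U -> U x ->
  (forall i y, U y -> derivable f y (delta_mx 0 i)) ->
  (forall i, {for x, continuous ('D_(delta_mx 0 i) f)}) ->
  differentiable f x.
Proof.
move=> oU Ux dfU cdf.
pose L v := \sum_i 'D_(delta_mx 0 i) f x * v 0 i.
have L_lin : linear L.
  move=> a u v; rewrite /L scaler_sumr -big_split; apply: eq_bigr => i _.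
  by rewrite !mxE mulrDr mulrCA.
pose LL := HB.pack L (GRing.isLinear.Build R 'rV[R]_d R^o *:%R L L_lin) :
  {linear 'rV[R]_d -> R^o}.
have cL : continuous LL.
  apply: (@continuous_big R^o _ +%R 0 _ _ _ _ (fun i v => 'D_(delta_mx 0 i) f x * v 0 i)).
    exact: add_continuous.
  move=> i _ v; apply: (@cvgM _ _ (nbhs v)); first exact: cvg_cst.
  exact: coord_continuous.
apply: (@differentiable_intro _ R^o f LL) => // e e0.
(* The denominator [d.+1] is positive even for [d = 0], and [d] errors of size [e' * |v|] add up to
   at most [e * |v|]. *)
pose e' := e / d.+1%:R.
have e'0 : 0 < e' by rewrite divr_gt0.
have : \forall y \near x, U y /\
    forall i, `|'D_(delta_mx 0 i) f y - 'D_(delta_mx 0 i) f x| <= e'.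
  apply: filterI; first exact: open_nbhs_nbhs.
  apply: (@filter_forall _ _ (fun i y =>
    `|'D_(delta_mx 0 i) f y - 'D_(delta_mx 0 i) f x| <= e') (nbhs x)) => i.
  have /cvgrPdist_le := cdf i => /(_ _ e'0).
  by apply: filterS => y; rewrite distrC.
move=> /nbhs_normP[r /= r0 xr]; exists r => // v vr.
have [y yx|xi xi_x E] := @rV_MVT f x v.
  by move=> i; apply: dfU; apply: (xr y _).1; rewrite /= distrC (le_lt_trans yx).
rewrite opprD addrA E /LL /= /L -sumrB.
apply: (le_trans (ler_norm_sum _ _ _)).
apply: (@le_trans _ _ (\sum_(i < d) e' * `|v|)).
  apply: ler_sum => i _; rewrite -mulrBl normrM ler_pM//.
    by apply: (xr _ _).2; rewrite /= distrC (le_lt_trans (xi_x i)).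
  by rewrite [leRHS]mx_normrE; exact: (le_bigmax _ _ (0, i)).
rewrite sumr_const card_ord -mulr_natl mulrA ler_wpM2r// /e' mulrCA.
by rewrite ler_piMr ?(ltW e0)// ler_pdivrMr// mul1r ler_nat.
Qed.

Lemma derive_sum_delta f x v : differentiable f x ->
  'D_v f x = \sum_i 'D_(delta_mx 0 i) f x * v 0 i.
Proof.
move=> dfx; rewrite deriveE// {1}(row_sum_delta v) linear_sum.
by apply: eq_bigr => i _; rewrite linearZ/= deriveE// mulrC.
Qed.

Lemma is_derive_comp_rV (V : normedModType R) f (G : V -> 'rV[R]_d) (y v : V) :
  differentiable f (G y) -> (forall i, derivable (fun z => G z 0 i) y v) ->
  is_derive y v (fun z => f (G z))
    (\sum_i 'D_(delta_mx 0 i) f (G y) * 'D_v (fun z => G z 0 i) y).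
Proof.
move=> df dG.
have dG' : derivable G y v.
  by apply/derivable_mxP => i j; rewrite ord1; exact: dG.
(* [G] is only known to be derivable in the direction [v], so [f \o G] is restricted to the line
   through [y]: for a curve, derivability and differentiability agree. *)
pose gam := fun h : R => G (h *: v + y).
have gam0 : gam 0 = G y by rewrite /gam scale0r add0r.
have dG0 : derivable G (0 *: v + y) v by rewrite scale0r add0r.
have [dgam1 Dgam] : is_derive (0 : R) 1 gam ('D_v G (0 *: v + y)).
  exact: (is_derive_line dG0).
have DG i : ('D_v G (0 *: v + y)) 0 i = 'D_v (fun z => G z 0 i) y.
  by rewrite (derive_mx dG0) mxE scale0r add0r.
have dgam0 : differentiable gam 0 by apply/derivable1_diffP.
have dfgam : differentiable (f \o gam) (0 : R).
  by apply: differentiable_comp; rewrite ?gam0.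
have E : (fun h : R => h^-1 *: (f (G (h *: v + y)) - f (G y))) =
   (fun h : R => h^-1 *: ((f \o gam) (h *: (1 : R^o) + 0) - (f \o gam) 0)).
  by apply/funext => h; rewrite /= gam0 /gam addr0 [h *: 1]mulr1.
have : derivable (f \o gam) 0 1 by exact: diff_derivable.
have : 'D_1 (f \o gam) 0 =
    \sum_i 'D_(delta_mx 0 i) f (G y) * 'D_v (fun z => G z 0 i) y.
  have df0 : differentiable f (gam 0) by rewrite gam0.
  rewrite (deriveE _ dfgam) (diff_comp dgam0 df0) /= -(deriveE (1 : R^o) dgam0) Dgam.
  rewrite gam0 -(deriveE _ df) (derive_sum_delta _ df).
  by apply: eq_bigr => i _; rewrite DG.
by rewrite /derivable /derive -E.
Qed.

End ChainRule.


(** * Functions of class C^k: localisation, sums, composition, coordinates *)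

Section CkTheory.
Context {R : realType}.

Lemma continuous_rV (d : nat) (T : topologicalType) (G : T -> 'rV[R]_d) y :
  (forall i, {for y, continuous (fun z => G z 0 i)}) -> {for y, continuous G}.
Proof.
move=> cG A [P Py PA]; apply: filterS; first by move=> z; exact: PA.
rewrite /=; apply: (@filter_forall _ _ (fun i z => forall j, P i j (G z i j)) (nbhs y)) => i.
apply: (@filter_forall _ _ (fun j z => P i j (G z i j)) (nbhs y)) => j.
by rewrite ord1 in Py *; exact: (cG j _ (Py 0 j)).
Qed.

Lemma Ck_sub (d k : nat) (U V : set 'rV[R]_d) f : V `<=` U -> Ck k U f -> Ck k V f.
Proof.
move=> VU; elim: k f => [|k IH] f [cf df]; split=> //; first by move=> x /VU/cf.
  by move=> x /VU/cf.
by move=> i; have [dfi Cfi] := df i; split; [move=> x /VU/dfi|exact: IH].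
Qed.

(** [Ck] is a condition at each point of its set, the derivatives being total functions; it can
    therefore be checked with a set [V] depending on the point. *)
Lemma Ck_local (d k : nat) (U : set 'rV[R]_d) f :
  (forall x, U x -> exists2 V : set 'rV[R]_d, V x & Ck k V f) -> Ck k U f.
Proof.
elim: k f => [|k IH] f loc; split=> //.
- by move=> x /loc[V Vx [+ _]]; exact.
- by move=> x /loc[V Vx [+ _]]; exact.
move=> i; split=> [x /loc[V Vx [_ /(_ i)[+ _]]]|]; first exact.
by apply: IH => x /loc[V Vx [_ /(_ i)[_ ?]]]; exists V.
Qed.

Lemma Ck_sum (d k : nat) (U : set 'rV[R]_d) (I : Type) (r : seq I) (f : I -> 'rV[R]_d -> R) :
  open U -> (forall i, Ck k U (f i)) -> Ck k U (fun y => \sum_(i <- r) f i y).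
Proof.
move=> oU Cf; elim: r => [|i r IH].
  by apply: (Ck_ext oU _ (Ck_cst k U 0)) => y _; rewrite big_nil.
by apply: (Ck_ext oU _ (Ck_add oU (Cf i) IH)) => y _; rewrite big_cons.
Qed.

Lemma Ck_differentiable (d : nat) (U : set 'rV[R]_d) f x :
  open U -> U x -> Ck 1 U f -> differentiable f x.
Proof.
move=> oU Ux [_ df]; apply: (C1_differentiable oU Ux) => [i y Uy|i].
  by have [+ _] := df i; apply.
by have [_ [+ _]] := df i; apply.
Qed.

(** Induction on [k]: by the chain rule a partial derivative of the composite is a sum of products
    of ['D_j f] composed with [G], covered by the induction hypothesis, and partial derivatives of
    the coordinates of [G]. *)
Lemma Ck_comp (d e k : nat) (U : set 'rV[R]_d) (W : set 'rV[R]_e) f (G : 'rV[R]_e -> 'rV[R]_d) :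
  open U -> open W -> (forall y, W y -> U (G y)) ->
  (forall i, Ck k W (fun y => G y 0 i)) -> Ck k U f -> Ck k W (fun y => f (G y)).
Proof.
move=> oU oW WU; elim: k f => [|k IH] f CG Cf.
all: have cfG y : W y -> {for y, continuous (fun y => f (G y))}
  by move=> Wy; apply: continuous_comp; [apply: continuous_rV => i; case: (CG i)=> + _; exact
     | case: Cf => + _; apply; exact: WU].
  by split.
split=> // i.
have Cf1 : Ck 1 U f.
  by elim: {IH CG cfG} k Cf => // k IH /CkS.
have dG y : W y -> is_derive y (delta_mx 0 i) (fun z => f (G z))
    (\sum_j 'D_(delta_mx 0 j) f (G y) * 'D_(delta_mx 0 i) (fun z => G z 0 j) y).
  move=> Wy; apply: is_derive_comp_rV; first exact: (Ck_differentiable oU (WU _ Wy)).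
  by move=> j; case: (CG j) => _ /(_ i)[+ _]; exact.
split=> [y /dG[]//|].
apply: (@Ck_ext _ _ k W (fun y => \sum_j ((fun z => 'D_(delta_mx 0 j) f (G z))
   * 'D_(delta_mx 0 i) (fun z => G z 0 j)) y) _ oW).
  by move=> y; rewrite inE => /dG[_ ->].
apply: (@Ck_sum _ _ _ _ _ (fun j => (fun z => 'D_(delta_mx 0 j) f (G z))
   * 'D_(delta_mx 0 i) (fun z => G z 0 j))) => // j; apply: Ck_mul => //.
  have [_ /(_ j)[_ Cfj]] := Cf.
  exact: (IH _ (fun j' => CkS (CG j')) Cfj).
by case: (CG j) => _ /(_ i)[].
Qed.

Lemma is_derive_coord (d : nat) (i : 'I_d) (x v : 'rV[R]_d) :
  is_derive x v (fun y : 'rV[R]_d => y 0 i) (v 0 i).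
Proof.
have := @derivable_id _ _ x v => /[dup] /derivable_mxP/(_ 0 i) dx /derive_mx.
rewrite derive_id => /rowP/(_ i); rewrite mxE => E.
by split=> //; rewrite -E.
Qed.

Lemma Ck_coord (d k : nat) (U : set 'rV[R]_d) (i : 'I_d) : Ck k U (fun y => y 0 i).
Proof.
case: k => [|k]; (split; first by move=> x _; exact: coord_continuous) => //.
move=> j; split=> [x _|]; first by have [] := is_derive_coord i x (delta_mx 0 j).
rewrite (_ : 'D__ _ = cst ((delta_mx 0 j : 'rV[R]_d) 0 i)); first exact: Ck_cst.
by apply/funext => x; have [_ ->] := is_derive_coord i x (delta_mx 0 j).
Qed.

End CkTheory.


(** * Hadamard's lemma on cubes *)

Section Cubes.
Context {R : realType} {d : nat}.
Implicit Types (a q x y z : 'rV[R]_d) (F : 'rV[R]_d -> R).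

(** Row vectors carry the sup norm, so balls are cubes. Their convexity keeps the segments used for
    Hadamard's lemma inside. *)
Definition open_cube a (r : R) : set 'rV[R]_d := [set y | `|y - a| < r].
Definition closed_cube a (r : R) : set 'rV[R]_d := [set y | `|y - a| <= r].

Lemma open_cube_open a r : open (open_cube a r).
Proof.
rewrite (_ : open_cube a r = ball a r); first exact: ball_open.
by rewrite -ball_normE; apply/funext => y; rewrite /open_cube/= distrC.
Qed.

Lemma closed_cube_compact a r : compact (closed_cube a r).
Proof.
apply: bounded_closed_compact.
  exists (r + `|a|); split; first exact: num_real.
  move=> M rM y yr; apply/ltW/(le_lt_trans _ rM).
  by rewrite -(subrK a y) (le_trans (ler_normD _ _))// lerD2r.
have -> : closed_cube a r = (fun y => `|y - a|) @^-1` [set t : R | t <= r] by [].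
apply: closed_comp; last exact: closed_le.
move=> y _; apply: (@continuous_comp _ _ _ (fun z => z - a) (fun z => `|z|)).
  apply: (@cvgB _ _ _ (nbhs y) _ id (cst a)); first exact: cvg_id.
  exact: cvg_cst.
exact: norm_continuous.
Qed.

Lemma continuous_closed_cube_bounded a r F : 0 <= r ->
  (forall y, closed_cube a r y -> {for y, continuous F}) ->
  exists2 C : R, 0 <= C & forall y, closed_cube a r y -> `|F y| <= C.
Proof.
move=> r0 cF.
have [|||c _ cP] := @EVT_max_rV R d (fun y => `|F y|) (closed_cube a r).
- by exists a; rewrite /closed_cube/= subrr normr0.
- exact: closed_cube_compact.
- apply: continuous_in_subspaceT => y; rewrite inE => /cF cFy.
  by apply: continuous_comp => //; exact: norm_continuous.
by exists `|F c| => // y yr; apply: cP; rewrite inE.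
Qed.

(** By [rV_MVT], bounded partial derivatives give a Lipschitz estimate at [x]. *)
Lemma bounded_partials_continuous (U : set 'rV[R]_d) F x (C : R) : open U -> U x ->
  (forall i y, U y -> derivable F y (delta_mx 0 i)) ->
  (forall i y, U y -> `|'D_(delta_mx 0 i) F y| <= C) ->
  {for x, continuous F}.
Proof.
move=> oU Ux dF bF.
have [r /= r0 xr] : exists2 r : R, 0 < r & forall y, `|x - y| < r -> U y.
  have : \forall y \near x, U y by exact: open_nbhs_nbhs.
  by move=> /nbhs_normP[r /= r0 xr]; exists r.
have lip y : `|y - x| < r -> `|F x - F y| <= (\sum_(i < d) C) * `|y - x|.
  move=> yxr; have [z zx i|xi xi_x] := @rV_MVT R d F x (y - x).
    by apply: dF; apply: xr; rewrite distrC (le_lt_trans zx).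
  rewrite subrK distrC => ->; rewrite mulr_suml (le_trans (ler_norm_sum _ _ _))//.
  apply: ler_sum => i _; rewrite normrM ler_pM//.
    by apply: bF; apply: xr; rewrite distrC (le_lt_trans (xi_x i)).
  by rewrite [leRHS]mx_normrE; exact: (le_bigmax _ _ (0, i)).
apply/(@cvgrPdist_le _ _ _ (nbhs x) (nbhs_filter x)) => e e0.
set D := \sum_(i < d) C in lip.
have D0 : 0 < `|D| + 1 by rewrite ltr_wpDl.
suff : \forall y \near x, `|F x - F y| <= e by [].
apply/nbhs_normP; exists (Num.min r (e / (`|D| + 1))); first by rewrite /= lt_min r0 divr_gt0.
move=> y /=; rewrite lt_min distrC => /andP[yr ye].
apply: (le_trans (lip y yr)); apply: (@le_trans _ _ ((`|D| + 1) * `|y - x|)).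
  by rewrite ler_wpM2r// (le_trans (ler_norm D))// lerDl.
by rewrite mulrC -ler_pdivlMr// ltW.
Qed.

End Cubes.


(** * Weighted averages along rays and Hadamard's lemma *)

Section RayAverage.
Context {R : realType} {d : nat}.
Implicit Types (a q x y z : 'rV[R]_d) (F : 'rV[R]_d -> R).

Definition ray q y (t : R) : 'rV[R]_d := t *: (y - q) + q.

(* The weight t ^+ m makes differentiation stay within the family:
   'D_j (ray_average m F q) = ray_average m.+1 ('D_j F) q. *)
Definition ray_average (m : nat) F q y : R :=
  \int[lebesgue_measure]_(t in `[0, 1]) (t ^+ m * F (ray q y t)).

Lemma ray_in_cube a (r : R) q y t : `|q - a| <= r -> `|y - a| <= r ->
  0 <= t <= 1 -> `|ray q y t - a| <= r.
Proof.
move=> qr yr /andP[t0 t1].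
have -> : ray q y t - a = t *: (y - a) + (1 - t) *: (q - a).
  apply/rowP => i; rewrite !mxE; ring.
apply: (le_trans (ler_normD _ _)); rewrite !normrZ.
rewrite (ger0_norm t0) ger0_norm ?subr_ge0//.
have : t * `|y - a| <= t * r by rewrite ler_wpM2l.
have : (1 - t) * `|q - a| <= (1 - t) * r by rewrite ler_wpM2l// subr_ge0.
lra.
Qed.

Lemma continuous_ray q y : continuous (ray q y).
Proof.
move=> t; apply: (@cvgD _ _ _ (nbhs t)); last exact: cvg_cst.
exact: scalel_continuous.
Qed.

Variables (a : 'rV[R]_d) (r : R).
Local Notation U := (open_cube a r).

Lemma ray_integrand_integrable m F q y : U q -> U y ->
  (forall z, U z -> {for z, continuous F}) ->
  lebesgue_measure.-integrable `[0, 1] (EFin \o (fun t : R => t ^+ m * F (ray q y t))).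
Proof.
move=> Uq Uy cF; apply: continuous_compact_integrable; first exact: segment_compact.
apply: continuous_in_subspaceT => t; rewrite inE/= in_itv/= => t01.
apply: (@continuousM R _ (fun t : R => t ^+ m) (fun t => F (ray q y t))).
  exact: exprn_continuous.
apply: continuous_comp; first exact: continuous_ray.
apply: cF; have qy : Num.max `|q - a| `|y - a| < r by rewrite gt_max Uq Uy.
by apply: le_lt_trans qy; apply: ray_in_cube; rewrite ?le_max ?lexx ?orbT.
Qed.

Lemma ray_average_bound (C rho : R) m F q y : rho < r -> 0 <= C ->
  (forall z, U z -> {for z, continuous F}) ->
  (forall z, closed_cube a rho z -> `|F z| <= C) ->
  closed_cube a rho q -> closed_cube a rho y -> `|ray_average m F q y| <= C.
Proof.
move=> rhor C0 cF FC qr yr.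
have Uq : U q by exact: le_lt_trans rhor.
have Uy : U y by exact: le_lt_trans rhor.
apply: le_trans (le_normr_Rintegral _ _) _ => //.
  exact: ray_integrand_integrable.
apply: (@le_trans _ _ (\int[lebesgue_measure]_(t in (`[0, 1] : set R)) C)).
  apply: le_Rintegral => //.
  - have := ray_integrand_integrable m Uq Uy cF; exact: integrable_norm.
  - apply: continuous_compact_integrable; first exact: segment_compact.
    by apply: continuous_in_subspaceT => t _; exact: cvg_cst.
  move=> t /=; rewrite in_itv/= => /[dup] t01 /andP[t0 t1].
  rewrite normrM -[leRHS]mul1r ler_pM//.
    by rewrite normrX (ger0_norm t0) exprn_ile1.
  by apply: FC; exact: ray_in_cube.
by rewrite Rintegral_cst//= lebesgue_measure_itv/= lte01 EFinN sube0 mulr1.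
Qed.


Lemma ray_average_diag F q : ray_average 0 F q q = F q.
Proof.
rewrite /ray_average (@eq_Rintegral _ _ _ _ _ (cst (F q))).
  by rewrite Rintegral_cst//= lebesgue_measure_itv/= lte01 EFinN sube0 mulr1.
by move=> t _; rewrite expr0 mul1r /ray subrr scaler0 add0r.
Qed.

(** Moving the endpoint by [s] along a coordinate moves the point at time [t] by [t * s]; this
    factor [t] is what raises the exponent of the weight in [ray_average]. *)
Lemma is_derive_ray F q y (j : 'I_d) (t s : R) :
  let x := ray q (s *: delta_mx 0 j + y) t in
  derivable F x (delta_mx 0 j) ->
  is_derive s 1 (fun s => F (ray q (s *: delta_mx 0 j + y) t))
    (t * 'D_(delta_mx 0 j) F x).
Proof.
move=> x dF.
have rayE s' : ray q (s' *: delta_mx 0 j + y) t = (t * s') *: delta_mx 0 j + ray q y t.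
  by apply/rowP => i; rewrite !mxE; ring.
rewrite (_ : (fun s => _) =
    (fun u => F (u *: delta_mx 0 j + ray q y t)) \o (fun s => t * s)); last first.
  by apply/funext => s'; rewrite rayE.
rewrite mulrC; apply: is_derive1_comp.
  by rewrite /x rayE; apply: is_derive_line; rewrite -rayE.
have := @is_deriveZ _ _ _ id t s 1 1 (is_derive_id s 1).
by rewrite /GRing.scale/= mulr1.
Qed.

(** Differentiation under the integral sign; the derivative of the integrand is dominated by a
    constant, a bound for ['D_j F] on a compact cube. *)
Lemma is_derive_ray_average m F q y (j : 'I_d) : U q -> U y -> 
  Ck 1 U F ->
  is_derive y (delta_mx 0 j) (ray_average m F q)
    (ray_average m.+1 ('D_(delta_mx 0 j) F) q y).
Proof.
move=> Uq Uy [cF dF].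
have [dFj [cDF _]] := dF j.
pose rho0 := Num.max `|q - a| `|y - a|.
(* [rho] is halfway between [rho0] and [r]: when the endpoint moves by less than [e], the rays stay
   in the closed cube of radius [rho], which still lies in the open cube of radius [r]. *)
pose e := (r - rho0) / 2; pose rho := rho0 + e.
have rho0r : rho0 < r by rewrite gt_max Uq Uy.
have e0 : 0 < e by rewrite divr_gt0// subr_gt0.
have rhor : rho < r by rewrite /rho /e; lra.
have rho00 : 0 <= rho0 by rewrite le_max normr_ge0.
have rho_ge0 : 0 <= rho by rewrite addr_ge0// ltW.
have KU : closed_cube a rho `<=` U by move=> z zr; exact: (le_lt_trans zr).
have Kq : closed_cube a rho q.
  by apply: ler_wpDr; [exact: ltW | rewrite le_max lexx].
have Kline (s : R) : `|s| < e -> closed_cube a rho (s *: delta_mx 0 j + y).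
  move=> se; rewrite /closed_cube/= -addrA (le_trans (ler_normD _ _))//.
  rewrite /rho [rho0 + e]addrC; apply: lerD; last by rewrite le_max lexx orbT.
  rewrite normrZ (le_trans _ (ltW se))// ler_piMr//.
  rewrite [leLHS]mx_normrE; apply/bigmax_leP; split => //= -[k i] _.
  by rewrite !mxE; case: (_ && _); rewrite ?normr1 ?normr0.
have [C C0 CP] : exists2 C : R, 0 <= C & forall z, closed_cube a rho z ->
    `|'D_(delta_mx 0 j) F z| <= C.
  by apply: continuous_closed_cube_bounded => // z /KU; exact: cDF.
pose f (s t : R) := t ^+ m * F (ray q (s *: delta_mx 0 j + y) t).
have fK (s t : R) : `]- e, e[%classic s -> `[0, 1]%classic t ->
    closed_cube a rho (ray q (s *: delta_mx 0 j + y) t).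
  rewrite /= !in_itv/= -ltr_norml => se t01; apply: ray_in_cube => //.
  exact: Kline.
have df (s t : R) : `]- e, e[%classic s -> `[0, 1]%classic t ->
   is_derive s 1 (f ^~ t)
     (t ^+ m.+1 * 'D_(delta_mx 0 j) F (ray q (s *: delta_mx 0 j + y) t)).
  move=> se t01; have dr := @is_derive_ray F q y j t s (dFj _ (KU _ (fK _ _ se t01))).
  have := @is_deriveZ _ _ _ _ (t ^+ m) s 1 _ dr.
  by rewrite /GRing.scale/= mulrA -exprSr.
have I0 : `]- e, e[%classic 0 by rewrite /= in_itv/= oppr_lt0 e0.
have key : h^-1 *: (\int[lebesgue_measure]_(t in `[0, 1]) f (h + 0) t -
      \int[lebesgue_measure]_(t in `[0, 1]) f 0 t) @[h --> 0^'] -->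
    \int[lebesgue_measure]_(t in `[0, 1]) partial1of2 f 0 t.
  apply: (@cvg_differentiation_under_integral R _ _ lebesgue_measure f `[0, 1]%classic
    (measurable_itv _) 0 (- e) e I0 _ _ (cst C)) => //.
  - move=> s se; apply: ray_integrand_integrable => //; apply/KU/Kline.
    by move: se; rewrite /= in_itv/= ltr_norml.
  - by move=> s t se t01; have [] := df s t se t01.
  - apply: continuous_compact_integrable; first exact: segment_compact.
    by apply: continuous_in_subspaceT => t _; exact: cvg_cst.
  - move=> s t se t01; rewrite partial1of2E; have [_ ->] := df s t se t01.
    move: (t01); rewrite /= in_itv/= => /andP[t0 t1].
    rewrite normrM -[leRHS]mul1r ler_pM//.
      by rewrite normrX (ger0_norm t0) exprn_ile1.
    by apply: CP; exact: fK.
have fE (h : R) : \int[lebesgue_measure]_(t in `[0, 1]) f h t =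
    ray_average m F q (h *: delta_mx 0 j + y) by [].
have lE : \int[lebesgue_measure]_(t in `[0, 1]) partial1of2 f 0 t =
    ray_average m.+1 ('D_(delta_mx 0 j) F) q y.
  apply: eq_Rintegral => t; rewrite inE => t01.
  by rewrite partial1of2E; have [_ ->] := df 0 t I0 t01; rewrite scale0r add0r.
have gE : (fun h : R => h^-1 *: (ray_average m F q (h *: delta_mx 0 j + y) -
      ray_average m F q y)) =
    (fun h : R => h^-1 *: (\int[lebesgue_measure]_(t in `[0, 1]) f (h + 0) t -
      \int[lebesgue_measure]_(t in `[0, 1]) f 0 t)).
  by apply/funext => h; rewrite !fE addr0 scale0r add0r.
rewrite lE -gE in key; split; last exact: cvg_lim.
by apply/cvg_ex; eexists; exact: key.
Qed.

(** The partial derivatives are again ray averages, hence bounded on a smaller closed cube, and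
    [bounded_partials_continuous] applies. *)
Lemma ray_average_continuous m F q y : U q -> U y -> Ck 1 U F ->
  {for y, continuous (ray_average m F q)}.
Proof.
move=> Uq Uy C1F; have [cF dF] := C1F.
pose rho0 := Num.max `|q - a| `|y - a|.
pose rho := (rho0 + r) / 2.
have rho0r : rho0 < r by rewrite gt_max Uq Uy.
have rho00 : 0 <= rho0 by rewrite le_max normr_ge0.
have rho_ge0 : 0 <= rho by rewrite /rho; lra.
have rhor : rho < r by rewrite /rho; lra.
have rho0rho : rho0 < rho by rewrite /rho; lra.
have KU : closed_cube a rho `<=` U by move=> z zr; exact: (le_lt_trans zr).
have Kq : closed_cube a rho q.
  by apply: (le_trans _ (ltW rho0rho)); rewrite le_max lexx.
have bnd (i : 'I_d) : exists C : R, forall z, closed_cube a rho z ->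
    `|ray_average m.+1 ('D_(delta_mx 0 i) F) q z| <= C.
  have [_ [cDF _]] := dF i.
  have [C C0 CP] : exists2 C : R, 0 <= C & forall z, closed_cube a rho z ->
      `|'D_(delta_mx 0 i) F z| <= C.
    by apply: continuous_closed_cube_bounded => // z /KU; exact: cDF.
  by exists C => z Kz; apply: (ray_average_bound (rho := rho)).
have [C CP] := choice bnd.
apply: (@bounded_partials_continuous _ _ (open_cube a rho) _ _ (\sum_i `|C i|)).
- exact: open_cube_open.
- by apply: le_lt_trans rho0rho; rewrite le_max lexx orbT.
- move=> i z /ltW zr; have [] // := is_derive_ray_average m i Uq (KU _ zr) C1F.
- move=> i z /ltW zr; have [_ ->] := is_derive_ray_average m i Uq (KU _ zr) C1F.
  rewrite (le_trans (CP i z zr))// (le_trans (ler_norm _))//.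
  by rewrite (bigD1 i)//= lerDl sumr_ge0.
Qed.

Lemma Ck_ray_average k m F q : U q -> smooth_on U F -> Ck k U (ray_average m F q).
Proof.
move=> Uq; elim: k m F => [|k IH] m F sF.
all: have cI y : U y -> {for y, continuous (ray_average m F q)}
  by move=> Uy; apply: ray_average_continuous => //; exact: sF.
  by split.
split=> // i.
have dI y : U y -> is_derive y (delta_mx 0 i) (ray_average m F q)
    (ray_average m.+1 ('D_(delta_mx 0 i) F) q y).
  by move=> Uy; exact: is_derive_ray_average.
split=> [y /dI[]//|].
have sDF : smooth_on U ('D_(delta_mx 0 i) F).
  by move=> k'; have [_ /(_ i)[]] := sF k'.+1.
apply: Ck_ext (IH m.+1 _ sDF); first exact: open_cube_open.
by move=> y; rewrite inE => /dI[_ ->].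
Qed.

Lemma Rintegral_lincomb (I : Type) (s : seq I) (c : I -> R) (f : I -> R -> R) :
  (forall i, lebesgue_measure.-integrable `[0, 1] (EFin \o f i)) ->
  lebesgue_measure.-integrable `[0, 1] (EFin \o (fun t => \sum_(i <- s) f i t * c i)) /\
  \int[lebesgue_measure]_(t in `[0, 1]) (\sum_(i <- s) f i t * c i) =
  \sum_(i <- s) (\int[lebesgue_measure]_(t in `[0, 1]) f i t) * c i.
Proof.
move=> fi; have mI := @measurable_itv R `[0, 1].
have fci i : lebesgue_measure.-integrable `[0, 1] (EFin \o (fun t => c i * f i t)).
  rewrite (_ : EFin \o _ = (fun t => (c i)%:E * (EFin \o f i) t)%E).
    exact: integrableZl.
  by apply/funext => t; rewrite /= EFinM.
elim: s => [|i s [IH1 IH2]].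
  split; last first.
    rewrite big_nil (@eq_Rintegral _ _ _ _ _ (cst 0)) ?Rintegral_cst ?mul0r//.
    by move=> t _; rewrite big_nil.
  rewrite (_ : EFin \o _ = cst 0%E); first exact: integrable0.
  by apply/funext => t /=; rewrite big_nil.
have E : (fun t => \sum_(j <- i :: s) f j t * c j) =
    (fun t => c i * f i t + \sum_(j <- s) f j t * c j).
  by apply/funext => t; rewrite big_cons mulrC.
rewrite E; split.
  rewrite (_ : EFin \o _ = (EFin \o (fun t => (c i * f i t)%R)) \+
      (EFin \o (fun t => \sum_(j <- s) f j t * c j)%R))%E.
    exact: integrableD.
  by apply/funext => t; rewrite /= EFinD.
by rewrite RintegralD// IH2 RintegralZl// big_cons mulrC.
Qed.

(** The fundamental theorem of calculus for [F] along the ray from [q] to [y]; the constant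
    coordinates of [y - q] come out of the integral. *)
Lemma hadamard F q y : U q -> U y -> Ck 1 U F ->
  F y - F q = \sum_i ray_average 0 ('D_(delta_mx 0 i) F) q y * (y - q) 0 i.
Proof.
move=> Uq Uy C1F; have [cF dF] := C1F.
have Uray (t : R) : 0 <= t <= 1 -> U (ray q y t).
  have qy : Num.max `|q - a| `|y - a| < r by rewrite gt_max Uq Uy.
  by move=> t01; apply: le_lt_trans qy; apply: ray_in_cube; rewrite ?le_max ?lexx ?orbT.
(* The trivial weight [t ^+ 0] makes [f i] literally the integrand of [ray_average 0]. *)
pose f i t := t ^+ 0 * 'D_(delta_mx 0 i) F (ray q y t).
pose g t := \sum_i f i t * (y - q) 0 i.
have dg (t : R) : 0 <= t <= 1 -> is_derive t 1 (fun t => F (ray q y t)) (g t).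
  move=> t01; have dFt : differentiable F (ray q y t).
    apply: (@Ck_differentiable R d (open_cube a r)) => //; last exact: Uray.
    exact: open_cube_open.
  have -> : g t = 'D_(y - q) F (ray q y t).
    rewrite derive_sum_delta//; apply: eq_bigr => i _.
    by rewrite /f expr0 mul1r.
  by apply: is_derive_line; exact: diff_derivable.
have fi i : lebesgue_measure.-integrable `[0, 1] (EFin \o f i).
  have [_ [cDF _]] := dF i.
  exact: (ray_integrand_integrable 0 Uq Uy cDF).
have [gi gE] := Rintegral_lincomb (index_enum 'I_d) (fun i => (y - q) 0 i) fi.
rewrite -[RHS]gE /Rintegral.
have cFray (t : R) : 0 <= t <= 1 -> {for t, continuous (fun t => F (ray q y t))}.
  by move=> t01; apply: continuous_comp; [exact: continuous_ray | exact/cF/Uray].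
rewrite (@continuous_FTC2 R g (fun t => F (ray q y t)) 0 1)//.
- by rewrite /ray scale1r subrK scale0r add0r.
- apply: continuous_in_subspaceT => t; rewrite inE/= in_itv/= => t01.
  rewrite /g; apply: (@cvg_big _ _ +%R 0 _ _ R (nbhs t) _
    (fun i s => f i s * (y - q) 0 i)) => [|i _].
    exact: add_continuous.
  apply: (@cvgM _ _ (nbhs t)); last exact: cvg_cst.
  apply: (@cvgM _ _ (nbhs t)); first exact: cvg_cst.
  have [_ [cDF _]] := dF i.
  apply: (@continuous_comp _ _ _ (ray q y) ('D_(delta_mx 0 i) F)).
    exact: continuous_ray.
  exact/cDF/Uray.
- split.
  + move=> t; rewrite in_itv/= => /andP[/ltW t0 /ltW t1].
    have t01 : 0 <= t <= 1 by rewrite t0 t1.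
    by have [] := dg t t01.
  + by apply: (cvg_at_right_filter (cFray 0 _)); rewrite lexx ler01.
  + by apply: (cvg_at_left_filter (cFray 1 _)); rewrite lexx ler01.
- move=> t; rewrite in_itv/= => /andP[/ltW t0 /ltW t1].
  have t01 : 0 <= t <= 1 by rewrite t0 t1.
  by rewrite derive1E; have [_ ->] := dg t t01.
Qed.

End RayAverage.


(** * Smooth bump functions *)

Section Bump.
Context {R : realType}.

(* The family is closed under differentiation up to linear combinations, which
   makes all its members smooth. *)
Definition flat_exp (m : nat) (s : R) : R :=
  if 0 < s then s^-1 ^+ m * expR (- s^-1) else 0.

(** The exponential series gives [expR s^-1 >= s^-1 ^+ m.+2 / (m.+2)!]. The resulting quadratic
    bound makes [flat_exp m] flat at the origin. *)
Lemma flat_exp_bound m (s : R) : 0 < s -> flat_exp m s <= (m.+2)`!%:R * s ^+ 2.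
Proof.
move=> s0; rewrite /flat_exp s0 expRN.
have v0 : 0 < s^-1 by rewrite invr_gt0.
have := expR_ge1Dxn m.+1 (ltW v0) => expB.
rewrite ler_pdivrMr ?expR_gt0//.
have e1 : s^-1 ^+ m.+2 / (m.+2)`!%:R <= expR s^-1 by apply: le_trans expB; rewrite lerDr.
have f0 : (0 : R) < (m.+2)`!%:R by rewrite ltr0n fact_gt0.
apply: (@le_trans _ _ ((m.+2)`!%:R * s ^+ 2 * (s^-1 ^+ m.+2 / (m.+2)`!%:R))).
  rewrite le_eqVlt; apply/orP; left; apply/eqP.
  rewrite (_ : m.+2 = (2 + m)%N)// exprD; field.
  by rewrite -?natrX !gt_eqF// ltr0n fact_gt0.
by rewrite ler_wpM2l// mulr_ge0 ?sqr_ge0// ltW.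
Qed.

Lemma flat_exp_ge0 m (s : R) : 0 <= flat_exp m s.
Proof.
rewrite /flat_exp; case: ifP => // s0.
by rewrite mulr_ge0 ?expR_ge0// exprn_ge0// invr_ge0 ltW.
Qed.

Lemma is_derive_flat_exp m (s : R) :
  is_derive s 1 (flat_exp m) (flat_exp m.+2 s - m%:R * flat_exp m.+1 s).
Proof.
have [s0|s0|<-] := ltgtP 0 s.
- rewrite /flat_exp s0.
  pose h (u : R) := u ^+ m * expR (- u).
  apply: (@near_eq_is_derive _ _ _ (h \o (fun s => s^-1))) => //.
    by near=> t; rewrite /h/= ifT//; near: t; exact: lt_nbhsr.
  have dV : is_derive s 1 (fun s : R => s^-1) (- s ^- 2).
    have := @is_deriveV _ id s 1 1 (lt0r_neq0 s0) (is_derive_id s 1).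
    by rewrite /GRing.scale/= mulr1.
  have dX (v : R) : is_derive v 1 (fun u : R => u ^+ m) (m%:R * v ^+ m.-1).
    have := @is_deriveX _ _ id m v 1 1 (is_derive_id v 1).
    by rewrite exprfctE /GRing.scale/= mulr1.
  have dE (v : R) : is_derive v 1 (expR \o -%R) (- expR (- v)).
    by rewrite -mulrN1; apply: is_derive1_comp.
  have dh (v : R) : is_derive v 1 h (v ^+ m * (- expR (- v))
      + expR (- v) * (m%:R * v ^+ m.-1)).
    exact: is_deriveM (dX v) (dE v).
  apply: is_derive_eq (is_derive1_comp (dh _) dV) _.
  case: m {h dX dh} => [|m] /=; rewrite ?exprS ?expr0; field; exact: lt0r_neq0.
- rewrite /flat_exp ifF ?ifF ?mulr0 ?subr0; try by rewrite ltNge ltW.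
  apply: (@near_eq_is_derive _ _ _ (cst 0)) => //.
  by near=> t; rewrite ifF//; apply/negbTE; rewrite -leNgt; apply/ltW; near: t; exact: lt_nbhsl.
- have psi0 k : flat_exp k (0 : R) = 0 by rewrite /flat_exp ltxx.
  (* At the origin the quadratic bound makes the difference quotient of order [h]. *)
  have key : h^-1 *: (flat_exp m (h *: (1 : R^o) + 0) - flat_exp m 0) @[h --> (0 : R)^'] --> (0 : R).
    apply/cvgrPdist_le => e e0; set C : R := (m.+2)`!%:R.
    have C0 : 0 < C by rewrite ltr0n fact_gt0.
    near=> h; rewrite sub0r normrN psi0 subr0 addr0 [h *: 1]mulr1 normrZ normfV.
    have h0 : 0 < `|h| by rewrite normr_gt0; near: h; exact: nbhs_dnbhs_neq.
    rewrite ler_pdivrMl// ger0_norm ?flat_exp_ge0//.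
    have [h_gt0|h_le0] := ltP 0 h; last first.
      by rewrite /flat_exp ltNge h_le0/= mulr_ge0// ltW.
    apply: (le_trans (flat_exp_bound m h_gt0)).
    have he : C * h < e.
      rewrite -ltr_pdivlMl// mulrC; apply: (le_lt_trans (ler_norm h)).
      by near: h; apply: dnbhs0_lt; exact: divr_gt0.
    by rewrite gtr0_norm// expr2 mulrA mulrC ler_wpM2l// ltW.
  rewrite !psi0 mulr0 subr0; split; last exact: cvg_lim.
  by apply/cvg_ex; exists 0; exact: key.
Unshelve. all: by end_near. Qed.

Lemma Ck_flat_exp (d k m : nat) (U : set 'rV[R]_d) (u : 'rV[R]_d -> R) : open U ->
  Ck k U u -> Ck k U (fun y => flat_exp m (u y)).
Proof.
move=> oU Cu.
have cm j (y : 'rV[R]_1) : {for y, continuous (fun y : 'rV[R]_1 => flat_exp j (y 0 0))}.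
  apply: (@continuous_comp _ _ _ (fun y : 'rV[R]_1 => y 0 0) (flat_exp j)).
    exact: coord_continuous.
  by apply/differentiable_continuous/derivable1_diffP; case: (is_derive_flat_exp j (y 0 0)).
(* [Ck] speaks of functions on row vectors, so [flat_exp m] is first viewed on rows of length one
   and then composed with [u]. *)
have : Ck k [set: 'rV[R]_1] (fun y => flat_exp m (y 0 0)).
  elim: k m {Cu} => [|k IH] m; first by split.
  split=> // i; rewrite (ord1 i).
  have dm (y : 'rV[R]_1) : is_derive y (delta_mx 0 0) (fun y : 'rV[R]_1 => flat_exp m (y 0 0))
      (flat_exp m.+2 (y 0 0) + (- m%:R) * flat_exp m.+1 (y 0 0)).
    have E : (fun h : R => h^-1 *: (flat_exp m ((h *: delta_mx 0 0 + y) 0 0) - flat_exp m (y 0 0)))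
      = (fun h : R => h^-1 *: (flat_exp m (h *: (1 : R^o) + y 0 0) - flat_exp m (y 0 0))).
      by apply/funext => h; rewrite !mxE.
    have [d1 d2] := is_derive_flat_exp m (y 0 0).
    split; first by move: d1; rewrite /derivable E.
    by move: d2; rewrite /derive E mulNr.
  split=> [y _|]; first by case: (dm y).
  rewrite (_ : 'D__ _ = (fun y : 'rV[R]_1 => flat_exp m.+2 (y 0 0)) +
      (cst (- m%:R) * (fun y : 'rV[R]_1 => flat_exp m.+1 (y 0 0)))); last first.
    by apply/funext => y; case: (dm y) => _ ->.
  by apply: Ck_add; [exact: openT|exact: IH|apply: Ck_mul; [exact: openT|exact: Ck_cst|exact: IH]].
move=> C1; have := @Ck_comp R 1 d k setT U _ (fun y => \row_(_ < 1) u y) openT oU _ _ C1.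
rewrite (_ : (fun y => flat_exp m ((\row__ u y) 0 0)) = (fun y => flat_exp m (u y))).
  apply => // i; apply: Ck_ext Cu => // y _; by rewrite mxE.
by apply/funext => y; rewrite mxE.
Qed.

(** The Euclidean squared distance is used because it is polynomial in the coordinates; a Euclidean
    ball of radius [r] lies in the cube of the same radius. *)
Definition smooth_bump (d : nat) (a : 'rV[R]_d) (r : R) (y : 'rV[R]_d) : R :=
  flat_exp 0 (r ^+ 2 - \sum_i (y 0 i - a 0 i) ^+ 2).

Lemma Ck_smooth_bump (d k : nat) (a : 'rV[R]_d) (r : R) U : open U -> Ck k U (smooth_bump a r).
Proof.
move=> oU; apply: Ck_flat_exp => //.
have Cya i : Ck k U (fun y => y 0 i + (- a 0 i)).
  exact: (Ck_add oU (Ck_coord k U i) (Ck_cst k U (- a 0 i))).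
have Cs : Ck k U (fun y => \sum_i (y 0 i - a 0 i) * (y 0 i - a 0 i)).
  apply: (@Ck_sum _ _ _ _ _ _ (fun i y => (y 0 i - a 0 i) * (y 0 i - a 0 i))) => // i.
  exact: (Ck_mul oU (Cya i) (Cya i)).
apply: Ck_ext (Ck_add oU (Ck_cst k U (r ^+ 2)) (Ck_mul oU (Ck_cst k U (-1)) Cs)) => //.
by move=> y _ /=; rewrite !fctE /= mulN1r; under eq_bigr do rewrite -expr2.
Qed.

Lemma smooth_bump_center_gt0 (d : nat) (a : 'rV[R]_d) (r : R) : 0 < r -> 0 < smooth_bump a r a.
Proof.
move=> r0; rewrite /smooth_bump big1 => [|i _]; last by rewrite subrr expr0n.
by rewrite subr0 /flat_exp exprn_gt0// expr0 mul1r expR_gt0.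
Qed.

Lemma smooth_bump_supp (d : nat) (a : 'rV[R]_d) (r : R) y : 0 < r ->
  smooth_bump a r y != 0 -> `|y - a| < r.
Proof.
move=> r0; rewrite /smooth_bump /flat_exp; case: ifP => [+ _|_ /eqP//].
rewrite subr_gt0 => yr; rewrite [ltLHS]mx_normrE; apply/bigmax_ltP; split => //= -[k i] _.
rewrite ord1 !mxE -(ltr_pXn2r (n := 2)) ?nnegrE ?(ltW r0)// real_normK ?num_real//.
by apply: le_lt_trans yr; rewrite (bigD1 i)//= lerDl sumr_ge0// => j _; exact: sqr_ge0.
Qed.

End Bump.


(** * Vector fields are locally generated by d derivations *)

Section VectorFieldCalculus.
Context {R : realType} {d : nat} {M : manifold R d}.
Implicit Types (X Y : vfield M) (f g : Cinfty M) (p : M).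

Lemma Cinfty_ext f g : (forall p, f p = g p) -> f = g.
Proof. by move=> fg; apply/val_inj/funext. Qed.

Lemma evD f g p : (f + g) p = f p + g p. Proof. by []. Qed.
Lemma evN f p : (- f) p = - f p. Proof. by []. Qed.
Lemma evM f g p : (f * g) p = f p * g p. Proof. by []. Qed.
Lemma ev0 p : (0 : Cinfty M) p = 0. Proof. by []. Qed.
Lemma ev1 p : (1 : Cinfty M) p = 1. Proof. by []. Qed.
Lemma ev_cst a p : cstC M a p = a. Proof. by []. Qed.
Lemma ev_sum (I : Type) (s : seq I) (F : I -> Cinfty M) p :
  (\sum_(i <- s) F i) p = \sum_(i <- s) F i p.
Proof. by elim: s => [|i s IH]; rewrite ?big_nil// !big_cons evD IH. Qed.

Definition evE := (evD, evN, evM, ev0, ev1, ev_cst).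

Lemma cstC0 : cstC M 0 = 0. Proof. exact: Cinfty_ext. Qed.
Lemma cstC1 : cstC M 1 = 1. Proof. exact: Cinfty_ext. Qed.

Lemma vfield_ext X Y : (forall f, X f = Y f :> Cinfty M) -> X = Y.
Proof. by move=> XY; apply/val_inj/funext. Qed.

Lemma vfD X f g : X (f + g) = X f + X g :> Cinfty M.
Proof.
have /asboolP[XL _] := vfield_der X.
by have := XL 1 f g; rewrite cstC1 !mul1r.
Qed.

Lemma vfM X f g : X (f * g) = X f * g + f * X g :> Cinfty M.
Proof. by have /asboolP[_ +] := vfield_der X; exact. Qed.

Lemma vf0 X : X 0 = 0 :> Cinfty M.
Proof. by apply: (addrI (X 0 : Cinfty M)); rewrite -vfD !addr0. Qed.

Lemma vf1 X : X 1 = 0 :> Cinfty M.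
Proof. by apply: (addrI (X 1 : Cinfty M)); rewrite addr0 -[in RHS](mulr1 1) vfM mulr1 mul1r. Qed.

Lemma vf_cstM X a f : X (cstC M a * f) = cstC M a * X f :> Cinfty M.
Proof.
have /asboolP[XL _] := vfield_der X.
by have := XL a f 0; rewrite vf0 !addr0.
Qed.

Lemma vf_cst X a : X (cstC M a) = 0 :> Cinfty M.
Proof. by rewrite -[cstC M a]mulr1 vf_cstM vf1 mulr0. Qed.

Lemma vfN X f : X (- f) = - X f :> Cinfty M.
Proof. by apply: (addrI (X f : Cinfty M)); rewrite -vfD !subrr vf0. Qed.

Lemma vfB X f g : X (f - g) = X f - X g :> Cinfty M.
Proof. by rewrite vfD vfN. Qed.

Lemma vf_sum X (I : Type) (s : seq I) (F : I -> Cinfty M) :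
  X (\sum_(i <- s) F i) = \sum_(i <- s) X (F i) :> Cinfty M.
Proof. by elim: s => [|i s IH]; rewrite ?big_nil ?vf0// !big_cons vfD IH. Qed.

Lemma vfield_addE X Y f : (X + Y) f = X f + Y f :> Cinfty M. Proof. by []. Qed.
Lemma vfield_oppE X f : (- X) f = - X f :> Cinfty M. Proof. by []. Qed.
Lemma vfield_scaleE h X f : (h *: X) f = h * X f :> Cinfty M. Proof. by []. Qed.
Lemma vfield_sumE (I : Type) (s : seq I) (F : I -> vfield M) f :
  (\sum_(i <- s) F i) f = \sum_(i <- s) F i f :> Cinfty M.
Proof. by elim: s => [|i s IH]; rewrite ?big_nil// !big_cons vfield_addE IH. Qed.

End VectorFieldCalculus.

(** * Extension by zero from a chart to the manifold *)

Section LocalFrame.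
Context {R : realType} {d : nat} {M : manifold R d}.
Implicit Types (X Y : vfield M) (f g : Cinfty M) (p : M).

Lemma chart_codomP (c : chart R d M) y :
  chart_codom c y -> chart_dom c (chart_inv c y) /\ c (chart_inv c y) = y.
Proof. by case=> x xc <-; rewrite chart_mapK ?inE. Qed.

Lemma chart_inv_preimage_open (c : chart R d M) (O : set M) : open O ->
  open (chart_codom c `&` chart_inv c @^-1` O).
Proof.
move=> oO; have := @chart_inv_continuous _ _ _ c.
rewrite continuous_open_subspace; last exact: chart_codom_open.
move=> cc; rewrite openE => y [cy Oy].
apply: filterI; first by apply: open_nbhs_nbhs; split => //; exact: chart_codom_open.
by apply: (cc y); [rewrite inE | apply: open_nbhs_nbhs].
Qed.

Lemma chart_map_preimage_open (c : chart R d M) (O : set 'rV[R]_d) : open O ->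
  open (chart_dom c `&` c @^-1` O).
Proof.
move=> oO; have := @chart_map_continuous _ _ _ c.
rewrite continuous_open_subspace; last exact: chart_dom_open.
move=> cc; rewrite openE => y [cy Oy].
apply: filterI; first by apply: open_nbhs_nbhs; split => //; exact: chart_dom_open.
by apply: (cc y); [rewrite inE | apply: open_nbhs_nbhs].
Qed.

Lemma chart_inv_compact_closed (c : chart R d M) (K : set 'rV[R]_d) :
  compact K -> K `<=` chart_codom c -> closed (chart_inv c @` K).
Proof.
move=> cK KU; apply: compact_closed; first exact: manifold_hausdorff.
apply: continuous_compact => //.
exact: (continuous_subspaceW KU (@chart_inv_continuous _ _ _ c)).
Qed.

Definition extend0 (c : chart R d M) (U : set 'rV[R]_d) (V : 'rV[R]_d -> R) (x : M) : R :=
  if `[< chart_dom c x /\ U (c x) >] then V (c x) else 0.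

(** Around a point of the chart over [U], the extension is [V] composed with a transition map. Any
    other point has a neighbourhood avoiding the image of [K], which is closed because the manifold
    is Hausdorff; the extension is zero there. *)
Lemma extend0_smooth (c : chart R d M) (U K : set 'rV[R]_d) (V : 'rV[R]_d -> R) :
  atlas c -> open U -> compact K -> K `<=` U -> U `<=` chart_codom c ->
  smooth_on U V -> (forall y, U y -> ~ K y -> V y = 0) ->
  extend0 c U V \in smooth_pred.
Proof.
move=> Ac oU cK KU Uc sV V0; apply/asboolP => c' Ac' k.
apply: Ck_local => y c'y; have [dy yE] := chart_codomP c'y.
pose O := chart_dom c `&` c @^-1` U.
have oO : open O by exact: chart_map_preimage_open.
have [Oy|nOy] := pselect (O (chart_inv c' y)).
  exists (chart_codom c' `&` chart_inv c' @^-1` O) => //.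
  have oW := chart_inv_preimage_open (c := c') oO.
  apply: (Ck_ext oW _ (@Ck_comp _ _ _ k U _ V (fun y => c (chart_inv c' y)) oU oW _ _ (sV k))).
  - by move=> z; rewrite inE => -[c'z Oz]; rewrite /= /extend0 asboolT.
  - by move=> z [_ []].
  move=> i; apply: Ck_sub (atlas_compatible Ac' Ac i k) => z [c'z [dz _]].
  have [d'z zE] := chart_codomP c'z.
  by exists (chart_inv c' z).
have oC := closed_openC (chart_inv_compact_closed cK (subset_trans KU Uc)).
exists (chart_codom c' `&` chart_inv c' @^-1` (~` (chart_inv c @` K))).
  split=> //= -[z Kz zE]; apply: nOy; rewrite -zE.
  by have [dz cz] := chart_codomP (Uc _ (KU _ Kz)); split => //=; rewrite cz; exact: KU.
apply: (Ck_ext (chart_inv_preimage_open (c := c') oC) _ (Ck_cst k _ 0)) => z.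
rewrite inE => -[c'z nKz] /=; rewrite /extend0; case: asboolP => // -[dz Uz].
rewrite V0// => Kz; apply: nKz; exists (c (chart_inv c' z)) => //.
by rewrite chart_mapK ?inE.
Qed.

End LocalFrame.



(** * Cut-off coordinate derivations generate the vector fields near a point *)

Section LocalGenerators.
Context {R : realType} {d : nat} {M : manifold R d}.
Implicit Types (X Y : vfield M) (f g : Cinfty M) (p : M).

Variables (c : chart R d M) (a : 'rV[R]_d) (r : R).
Hypotheses (Ac : atlas c) (r0 : 0 < r) (Uc : open_cube a r `<=` chart_codom c).
Local Notation U := (open_cube a r).
Local Notation rep f := (fun y : 'rV[R]_d => f (chart_inv c y)).

(** Radius [r / 2] puts the support of [b] in a compact subset of [U]. *)
Let b : 'rV[R]_d -> R := smooth_bump a (r / 2).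

Let r20 : 0 < r / 2. Proof. by rewrite divr_gt0. Qed.

Lemma localized_smooth (V : 'rV[R]_d -> R) : smooth_on U V ->
  extend0 c U (b * V) \in smooth_pred.
Proof.
move=> sV; apply: (@extend0_smooth _ _ _ _ _ (closed_cube a (r / 2))) => //.
- exact: open_cube_open.
- exact: closed_cube_compact.
- by move=> y; rewrite /closed_cube/= => yr; apply: (le_lt_trans yr); rewrite ltr_pdivrMr// ltr_pMr// ltr1n.
- by move=> k; apply: Ck_mul (sV k); [|apply: Ck_smooth_bump]; exact: open_cube_open.
move=> y Uy nKy; rewrite !fctE.
have [b0|/(smooth_bump_supp r20)/ltW//] := eqVneq (b y) 0.
by rewrite b0 mul0r.
Qed.

Definition localized V (sV : smooth_on U V) : Cinfty M := CinftyOf (localized_smooth sV).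

Lemma localizedE V (sV : smooth_on U V) (x : M) :
  localized sV x = if `[< chart_dom c x /\ U (c x) >] then b (c x) * V (c x) else 0.
Proof. by []. Qed.

Lemma rep_smooth f : smooth_on U (rep f).
Proof.
by move=> k; apply: Ck_sub Uc _; have /asboolP sf := Cinfty_smooth f; exact: sf.
Qed.

Lemma drep_smooth (i : 'I_d) f : smooth_on U ('D_(delta_mx 0 i) (rep f)).
Proof. by move=> k; have [_ /(_ i)[]] := rep_smooth f k.+1. Qed.

Lemma rep_derivable (i : 'I_d) f y : U y -> derivable (rep f) y (delta_mx 0 i).
Proof. by have [_ /(_ i)[+ _]] := rep_smooth f 1; apply. Qed.

(** The cut-off by [b] turns the coordinate derivation into a globally defined one. *)
Definition partial_fun (i : 'I_d) f : Cinfty M := localized (drep_smooth i f).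

Lemma partial_der i : (partial_fun i : Cinfty M -> (Cinfty M)^o) \in derivation_pred (M := M).
Proof.
apply/asboolP; split=> [s f g|f g]; apply: Cinfty_ext => x.
  rewrite !evE !localizedE; case: asboolP => [[dx Ux]|]; last by rewrite mulr0 addr0.
  have df := @rep_derivable i f _ Ux; have dg := @rep_derivable i g _ Ux.
  have -> : rep (cstC M s * f + g) = s *: rep f + rep g by [].
  rewrite (deriveD (derivableZ df) dg) (deriveZ _ df).
  by rewrite mulrDr mulrCA.
rewrite !evE !localizedE; case: asboolP => [[dx Ux]|]; last by rewrite mulr0 mul0r addr0.
have df := @rep_derivable i f _ Ux; have dg := @rep_derivable i g _ Ux.
have -> : rep (f * g) = rep f * rep g by [].
rewrite (deriveM df dg) /GRing.scale/= chart_mapK ?inE//; ring.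
Qed.

Definition partial_field i : vfield M := VField (partial_der i).

Lemma partial_fieldE i f x : (partial_field i f : Cinfty M) x =
  if `[< chart_dom c x /\ U (c x) >] then
    b (c x) * 'D_(delta_mx 0 i) (rep f) (c x) else 0.
Proof. by []. Qed.

Lemma cst1_smooth : smooth_on U (cst 1). Proof. by move=> k; exact: Ck_cst. Qed.
Lemma coord_smooth (i : 'I_d) : smooth_on U (fun y : 'rV[R]_d => y 0 i).
Proof. by move=> k; exact: Ck_coord. Qed.

Definition loc_bump : Cinfty M := localized cst1_smooth.
Definition loc_coord i : Cinfty M := localized (coord_smooth i).

(* Hadamard's lemma at q := c x, multiplied by loc_bump ^ 2, writes
   loc_bump ^ 2 * (f - f x) as a sum of products of functions, the first factor
   of each vanishing at x; applying X and evaluating at x gives X f x. *)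
Lemma loc_bump_cubeM X :
  (loc_bump * loc_bump * loc_bump) *: X =
  \sum_i (loc_bump * X (loc_coord i) - loc_coord i * X loc_bump) *: partial_field i.
Proof.
apply: vfield_ext => f; apply: Cinfty_ext => x.
rewrite vfield_sumE ev_sum vfield_scaleE.
have [in_x|out_x] := pselect (chart_dom c x /\ U (c x)); last first.
  rewrite big1 => [|i _]; last by rewrite vfield_scaleE evM partial_fieldE asboolF// mulr0.
  by rewrite !evE localizedE asboolF// !mul0r.
have [dx Ux] := in_x; set q := c x in Ux *.
have Hs (i : 'I_d) : smooth_on U (ray_average 0 ('D_(delta_mx 0 i) (rep f)) q).
  by move=> k; apply: Ck_ray_average => //; exact: drep_smooth.
have key : loc_bump * loc_bump * (f - cstC M (f x)) =
    \sum_i (loc_coord i - cstC M (q 0 i) * loc_bump) * localized (Hs i).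
  apply: Cinfty_ext => z; rewrite ev_sum !evE.
  have [[dz Uz]|out_z] := pselect (chart_dom c z /\ U (c z)); last first.
    rewrite big1 => [|i _]; last by rewrite !evE !localizedE asboolF// mulr0.
    by rewrite localizedE asboolF// !mul0r.
  have C1f : Ck 1 U (rep f) by exact: rep_smooth.
  have := hadamard Ux Uz C1f; rewrite /q !chart_mapK ?inE// => ->.
  rewrite mulr_sumr; apply: eq_bigr => i _.
  rewrite !evE !localizedE !asboolT//= !mxE; ring.
have bx : loc_bump x = b q by rewrite localizedE asboolT// mulr1.
have := congr1 (fun h : Cinfty M => (X h : Cinfty M) x) key.
rewrite vf_sum ev_sum vfM vfB vf_cst !evE subrr mulr0 add0r subr0 bx => keyX.
(* The third factor [b q] turns the constant [q 0 i] into the value of [loc_coord i] at [x], so the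
   coefficients become smooth functions independent of [x]. *)
rewrite -[b q * b q * b q]mulrA -[LHS]mulrA keyX mulr_sumr.
apply: eq_bigr => i _.
rewrite vfield_scaleE vfM vfB vf_cstM !evE partial_fieldE bx !localizedE !asboolT//= -/q.
by rewrite ray_average_diag; ring.
Qed.

End LocalGenerators.

Lemma local_generators (R : realType) (d : nat) (M : manifold R d) (p : M) :
  exists2 beta : Cinfty M, beta p != 0 &
  exists D : 'I_d -> vfield M, forall X, exists cs : 'I_d -> Cinfty M,
    beta *: X = \sum_i cs i *: D i.
Proof.
have [c Ac cp] := atlas_cover p.
have : \forall y \near c p, chart_codom c y.
  by apply: open_nbhs_nbhs; split; [exact: chart_codom_open | exists p].
move=> /nbhs_normP[r /= r0 rc].
have Uc : open_cube (c p) r `<=` chart_codom c by move=> y yr; apply: rc; rewrite /= distrC.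
have bump_p : loc_bump Ac r0 Uc p != 0.
  rewrite localizedE asboolT ?mulr1.
    by rewrite gt_eqF// smooth_bump_center_gt0// divr_gt0.
  by split=> //; rewrite /open_cube/= subrr normr0.
exists (loc_bump Ac r0 Uc * loc_bump Ac r0 Uc * loc_bump Ac r0 Uc).
  by rewrite !evE !mulf_neq0.
exists (partial_field Ac r0 Uc) => X; eexists; exact: loc_bump_cubeM.
Qed.



(** * Metric, connection and curvature *)

Section RiemannianCalculus.
Context {R : realType} {d : nat} {M : manifold R d}.
Variables (g : vfield M -> vfield M -> Cinfty M) (nabla : vfield M -> vfield M -> vfield M).
Hypotheses (Hg : riemannian_metric g) (Hn : levi_civita g nabla).
Implicit Types (X Y Z W U V : vfield M) (f h : Cinfty M) (p q : M).

Lemma gDl X Y Z : g (X + Y) Z = g X Z + g Y Z.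
Proof. by have := metric_linear Hg 1 X Y Z; rewrite scale1r mul1r. Qed.
Lemma g0l Z : g 0 Z = 0.
Proof. by apply: (addrI (g 0 Z)); rewrite -gDl !addr0. Qed.
Lemma gZl f X Z : g (f *: X) Z = f * g X Z.
Proof. by have := metric_linear Hg f X 0 Z; rewrite !addr0 g0l addr0. Qed.
Lemma gNl X Z : g (- X) Z = - g X Z.
Proof. by apply: (addrI (g X Z)); rewrite -gDl !subrr g0l. Qed.
Lemma gBl X Y Z : g (X - Y) Z = g X Z - g Y Z.
Proof. by rewrite gDl gNl. Qed.
Lemma gC X Y : g X Y = g Y X. Proof. exact: (Defs.metric_sym Hg). Qed.
Lemma gDr X Y Z : g X (Y + Z) = g X Y + g X Z.
Proof. by rewrite gC gDl !(gC X). Qed.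
Lemma gZr f X Z : g X (f *: Z) = f * g X Z.
Proof. by rewrite gC gZl (gC X). Qed.
Lemma gNr X Z : g X (- Z) = - g X Z.
Proof. by rewrite gC gNl (gC X). Qed.
Lemma g0r X : g X 0 = 0. Proof. by rewrite gC g0l. Qed.
Lemma g_sum (I : Type) (s : seq I) (F : I -> vfield M) Z :
  g (\sum_(i <- s) F i) Z = \sum_(i <- s) g (F i) Z.
Proof. by elim: s => [|i s IH]; rewrite ?big_nil ?g0l// !big_cons gDl IH. Qed.

(** This turns equations between vector fields into pointwise statements about norms: a non-zero
    value of [X f] at [p] makes the tangent vector at [p] non-zero. *)
Lemma metric_definite X : (forall p, g X X p = 0) -> X = 0.
Proof.
move=> gX0; apply: vfield_ext => f; apply: Cinfty_ext => p.
apply: contrapT => Xfp.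
have Xp : tangent X p <> cst 0 by move=> /(congr1 (@^~ f)).
by have := metric_pos Hg Xp; rewrite gX0 ltxx.
Qed.


Lemma nablaDl X Y Z : nabla (X + Y) Z = nabla X Z + nabla Y Z.
Proof. by have := nabla_linear Hn 1 X Y Z; rewrite !scale1r. Qed.
Lemma nabla0l Z : nabla 0 Z = 0.
Proof. by apply: (addrI (nabla 0 Z)); rewrite -nablaDl !addr0. Qed.
Lemma nablaZl f X Z : nabla (f *: X) Z = f *: nabla X Z.
Proof. by have := nabla_linear Hn f X 0 Z; rewrite !addr0 nabla0l addr0. Qed.
Lemma nablaNl X Z : nabla (- X) Z = - nabla X Z.
Proof. by apply: (addrI (nabla X Z)); rewrite -nablaDl !subrr nabla0l. Qed.
Lemma nablaDr X Y Z : nabla X (Y + Z) = nabla X Y + nabla X Z.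
Proof. exact: (nabla_add Hn). Qed.
Lemma nabla0r X : nabla X 0 = 0.
Proof. by apply: (addrI (nabla X 0)); rewrite -nablaDr !addr0. Qed.

Lemma derive_metric X Y Z : X (g Y Z) = g (nabla X Y) Z + g Y (nabla X Z) :> Cinfty M.
Proof. exact: (nabla_metric Hn). Qed.

Lemma bracketE X Y : bracket X Y = nabla X Y - nabla Y X.
Proof. by rewrite (nabla_torsion_free Hn). Qed.

Lemma curvatureDr X Y Z W :
  curvature nabla X Y (Z + W) = curvature nabla X Y Z + curvature nabla X Y W.
Proof.
rewrite /curvature !nablaDr !opprD !addrA.
by rewrite [LHS](ACl (1*3*5*2*4*6)).
Qed.

Lemma curvatureZr f X Y Z : curvature nabla X Y (f *: Z) = f *: curvature nabla X Y Z.
Proof.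
rewrite /curvature !(nabla_leibniz Hn) !nablaDr !(nabla_leibniz Hn).
have -> : bracket X Y f = X (Y f) - Y (X f) :> Cinfty M by [].
apply: vfield_ext => h.
rewrite !(vfield_addE, vfield_oppE, vfield_scaleE); ring.
Qed.

(** Expand the action of [bracket X Y] on [g Z W] both directly and as a commutator, using metric
    compatibility. *)
Lemma curvature_skew X Y Z W :
  g (curvature nabla X Y Z) W = - g Z (curvature nabla X Y W).
Proof.
have := erefl (bracket X Y (g Z W) : Cinfty M).
rewrite {1}(_ : bracket X Y (g Z W) = X (Y (g Z W)) - Y (X (g Z W)) :> Cinfty M) //.
rewrite !derive_metric !vfD !derive_metric /curvature !(gBl, gDr, gNr) => E.
apply/eqP; rewrite -subr_eq0 opprK; apply/eqP.
move/eqP: E; rewrite -subr_eq0 => /eqP <-; ring.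
Qed.

End RiemannianCalculus.

(** * Identities on the set where [rho] does not vanish *)

Section Vanish.
Context {R : realType} {d : nat} {M : manifold R d}.
Implicit Types (U : vfield M) (rho h : Cinfty M) (p : M).

Definition vanishes_off_zeros rho h := forall p, rho p != 0 -> h p = 0.

(** The product [rho * h] is zero everywhere. Differentiating it leaves [rho * U h = 0] where [rho]
    is non-zero, an algebraic substitute for the locality of derivations. *)
Lemma vanishes_off_zeros_deriv rho h U :
  vanishes_off_zeros rho h -> vanishes_off_zeros rho (U h).
Proof.
move=> h0; have rh : rho * h = 0.
  apply: Cinfty_ext => p; rewrite !evE; have [->|/h0->] := eqVneq (rho p) 0.
    by rewrite mul0r.
  by rewrite mulr0.
move=> p rp; have := congr1 (fun f => (U f : Cinfty M) p) rh.
rewrite vfM vf0 !evE h0// mulr0 add0r => /eqP.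
by rewrite mulf_eq0 (negbTE rp) => /eqP.
Qed.

End Vanish.

(** * Linear dependence of four vector fields at a point *)

Section ThreeDimensional.
Context {R : realType} {M : manifold R 3}.
Variables (g : vfield M -> vfield M -> Cinfty M).
Hypothesis Hg : riemannian_metric g.

(** Three local generators give a 4 by 3 coefficient matrix at [p], and a vector of its left kernel
    is the relation. Dependence of the tangent vectors is expressed by pairing with all [W]. *)
Lemma four_fields_dependent (V : 'I_4 -> vfield M) (p : M) :
  exists2 u : 'I_4 -> R, exists j, u j != 0 &
    forall W, \sum_j u j * g (V j) W p = 0.
Proof.
have [beta bp [D DP]] := local_generators p.
have [cs csP] := choice (fun j => DP (V j)).
pose A : 'M[R]_(4, 3) := \matrix_(j, i) cs j i p.
have /rowV0Pn[u /sub_kermxP uA u0] : kermx A != 0.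
  by rewrite kermx_eq0 -row_leq_rank -ltnNge (leq_ltn_trans (rank_leq_col A)).
exists (fun j => u 0 j); first by apply/rV0Pn.
move=> W; apply/eqP; rewrite -(inj_eq (mulfI bp)) mulr0 mulr_sumr; apply/eqP.
have bV j : beta p * g (V j) W p = \sum_i A j i * g (D i) W p.
  have := congr1 (fun X => g X W p) (csP j).
  rewrite /= gZl// g_sum// ev_sum !evE => ->; apply: eq_bigr => i _.
  by rewrite gZl// evM mxE.
under eq_bigr do rewrite mulrCA bV mulr_sumr.
rewrite exchange_big big1// => i _.
transitivity ((u *m A) 0 i * g (D i) W p); last by rewrite uA mxE mul0r.
by rewrite mxE mulr_suml; apply: eq_bigr => j _; rewrite mulrA.
Qed.

Lemma no_orthogonal_quadruple (V : 'I_4 -> vfield M) (p : M) :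
  (forall i j, i != j -> g (V i) (V j) p = 0) -> exists j, g (V j) (V j) p = 0.
Proof.
move=> orth; have [u [j uj] /(_ (V j))] := four_fields_dependent V p.
rewrite (bigD1 j)//= big1 => [|i ij]; last by rewrite orth// mulr0.
by rewrite addr0 => /eqP; rewrite mulf_eq0 (negbTE uj) => /eqP; exists j.
Qed.

End ThreeDimensional.



(** * Contact metric manifolds of dimension 3 *)

Section ContactThreeManifold.
Context {R : realType} {M : manifold R 3}.
Variables (eta : {scalar vfield M}) (xi : vfield M)
  (g : vfield M -> vfield M -> Cinfty M)
  (phi : {linear vfield M -> vfield M})
  (nabla : vfield M -> vfield M -> vfield M).
Hypotheses (Hc : contact_metric (n := 1) eta xi g phi) (Hn : levi_civita g nabla).
Implicit Types (X Y Z W U V E : vfield M) (f h : Cinfty M) (p q : M).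

Let Hg : riemannian_metric g := contact_riemannian Hc.

Let gE := (gDl Hg, gZl Hg, gNl Hg, gDr Hg, gZr Hg, gNr Hg, g0l Hg, g0r Hg).

Lemma metric_xi X : g X xi = eta X.
Proof. by rewrite (contact_eta Hc). Qed.

Lemma eta_xi : eta xi = 1. Proof. exact: (contact_xi Hc). Qed.

Lemma ext_derivC X Y : ext_deriv eta X Y = - ext_deriv eta Y X.
Proof.
rewrite /ext_deriv.
have -> : bracket X Y = - bracket Y X.
  apply: vfield_ext => f; rewrite vfield_oppE /= opprB; exact.
rewrite linearN -mulrN; congr (_ * _); ring.
Qed.

Lemma metric_phi_skew X Y : g X (phi Y) = - g (phi X) Y.
Proof. by rewrite (gC Hg (phi X)) -!(contact_deta Hc) ext_derivC. Qed.

Lemma phi_xi : phi xi = 0.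
Proof.
apply: (metric_definite Hg) => p.
by rewrite -(contact_deta Hc) ext_derivC (contact_reeb Hc) oppr0.
Qed.

Lemma eta_phi X : eta (phi X) = 0.
Proof. by rewrite -metric_xi -[g _ _]opprK -metric_phi_skew phi_xi gE oppr0. Qed.

Lemma metric_phi_phi X Y : g (phi X) (phi Y) = g X Y - eta X * eta Y.
Proof.
rewrite metric_phi_skew (contact_phi2 Hc) !gE (gC Hg xi) metric_xi; ring.
Qed.

Lemma eta_nabla_xi X : eta (nabla X xi) = 0.
Proof.
have := derive_metric Hn X xi xi.
rewrite metric_xi eta_xi vf1 (gC Hg xi) metric_xi => E.
have : cstC M 2 * eta (nabla X xi) = 0.
  rewrite [RHS]E; apply: Cinfty_ext => p; rewrite !evE; ring.
by move=> /(congr1 (fun f => cstC M 2^-1 * f)); rewrite mulr0 mulrA => <-;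
  apply: Cinfty_ext => p; rewrite !evE mulVf// mul1r.
Qed.

(** The exterior derivative of [eta] written with the torsion-free connection; the factor 2 undoes
    the 1/2 in [ext_deriv]. *)
Lemma nabla_xi_skew X Y :
  g (nabla X xi) Y - g (nabla Y xi) X = cstC M 2 * g X (phi Y).
Proof.
rewrite -(contact_deta Hc) /ext_deriv -!metric_xi (bracketE Hn) !(derive_metric Hn) !gE.
rewrite (gC Hg X) (gC Hg Y (nabla X xi)).
by apply: Cinfty_ext => p; rewrite !evE; field.
Qed.

(** The integral curves of [xi] are geodesics: pairing [nabla_xi_skew] with [nabla xi xi] itself
    leaves only its squared norm. *)
Lemma nabla_xi_xi : nabla xi xi = 0.
Proof.
apply: (metric_definite Hg) => p.
have := nabla_xi_skew xi (nabla xi xi).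
rewrite metric_xi eta_nabla_xi subr0 => ->.
by rewrite metric_phi_skew phi_xi !gE oppr0 mulr0.
Qed.

(** * The orthogonal frame [E], [phi E], [xi] *)

Section Frame.
Variable E : vfield M.
Hypothesis etaE : eta E = 0.
Local Notation F := (phi E).
Local Notation rho := (g E E).

Lemma frame_norm : g F F = rho.
Proof. by rewrite metric_phi_phi etaE mulr0 subr0. Qed.

Lemma frame_orth : g E F = 0.
Proof.
apply: Cinfty_ext => p; have := congr1 (fun h : Cinfty M => h p) (metric_phi_skew E E).
by rewrite (gC Hg (phi E)) !evE; lra.
Qed.

(** Where [rho] is non-zero, [Z], [E], [F], [xi] are mutually orthogonal and the last three have
    non-zero norm, so [Z] vanishes by dimension. Where [rho] is zero, so is [rho *: Z]. *)
Lemma frame_complete Z : g Z E = 0 -> g Z F = 0 -> eta Z = 0 -> rho *: Z = 0.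
Proof.
rewrite -metric_xi => ZE ZF Zx; apply: (metric_definite Hg) => p; rewrite !gE !evE.
have [->|rp] := eqVneq (rho p) 0; first by rewrite mul0r.
pose Vs (j : 'I_4) : vfield M := nth Z [:: Z; E; F; xi] j.
have [|j] := @no_orthogonal_quadruple _ _ _ Hg Vs p.
  case=> [[|[|[|[|//]]]] ? ] [[|[|[|[|//]]]] ?]//= _; rewrite /Vs/=.
  all: rewrite ?(gC Hg E Z) ?(gC Hg F Z) ?(gC Hg xi Z) ?ZE ?ZF ?Zx//.
  all: rewrite ?(gC Hg F E) ?frame_orth ?(gC Hg xi) ?metric_xi ?etaE ?eta_phi//.
case: j => [[|[|[|[|//]]]] ? ]; rewrite /Vs/=.
- by move=> ->; rewrite !mulr0.
- by move=> rp0; rewrite rp0 eqxx in rp.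
- by rewrite frame_norm => rp0; rewrite rp0 eqxx in rp.
- by rewrite metric_xi eta_xi ev1 => /eqP; rewrite oner_eq0.
Qed.

(** Orthogonal expansion with cleared denominators, as [E] and [F] have squared norm [rho]; the
    outer [rho] comes from [frame_complete]. *)
Lemma frame_expansion X :
  rho *: (rho *: X) = rho *: ((rho * eta X) *: xi + g X E *: E + g X F *: F).
Proof.
apply/eqP; rewrite -subr_eq0 -scalerBr; apply/eqP; apply: frame_complete.
- by rewrite !gE (gC Hg xi) metric_xi etaE (gC Hg F E) frame_orth; ring.
- by rewrite !gE (gC Hg xi) metric_xi eta_phi frame_orth frame_norm; ring.
- by rewrite -metric_xi !gE !metric_xi eta_xi etaE eta_phi; ring.
Qed.

Lemma frame_linear (T : vfield M -> Cinfty M) q X :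
  (forall f Z W, T (f *: Z + W) = f * T Z + T W) -> rho q != 0 ->
  rho q * T X q = rho q * eta X q * T xi q + g X E q * T E q + g X F q * T F q.
Proof.
move=> TL rq.
have T0 : T 0 = 0.
  by apply: (addrI (T 0)); have := TL 1 0 0; rewrite scaler0 mul1r !addr0.
have TZ f Z : T (f *: Z) = f * T Z by have := TL f Z 0; rewrite !addr0 T0 addr0.
have := congr1 (fun Z => T Z q) (frame_expansion X).
rewrite /= !TZ -addrA !TL TZ !evE => /(mulfI rq) ->; ring.
Qed.

Lemma frame_metric q X Y : rho q != 0 ->
  rho q * g X Y q = rho q * eta X q * eta Y q + g X E q * g Y E q + g X F q * g Y F q.
Proof.
move=> rq; rewrite (@frame_linear (fun X => g X Y) q X)//.
  by rewrite (gC Hg xi) metric_xi !(gC Hg Y).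
by move=> f Z W; rewrite !gE.
Qed.

Lemma frame_nabla_xi q X Y : rho q != 0 ->
  rho q * g (nabla X xi) Y q =
  g X E q * g (nabla E xi) Y q + g X F q * g (nabla F xi) Y q.
Proof.
move=> rq; rewrite (@frame_linear (fun X => g (nabla X xi) Y) q X)//.
  by rewrite nabla_xi_xi !gE mulr0 add0r.
by move=> f Z W; rewrite (nablaDl Hn) (nablaZl Hn) !gE.
Qed.

End Frame.

(** Otherwise [g] vanishes at [p] on the kernel of [eta], by polarisation; then so does the exterior
    derivative of [eta], against the contact condition. *)
Lemma horizontal_exists p : exists2 E, eta E = 0 & g E E p != 0.
Proof.
apply: contrapT => nE.
have gE0 X : eta X = 0 -> g X X p = 0.
  by move=> eX; apply/eqP/negP => /negP gX; apply: nE; exists X.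
have gEF0 X Y : eta X = 0 -> eta Y = 0 -> g X Y p = 0.
  move=> eX eY; have := gE0 (X + Y); rewrite linearD eX eY addr0 => /(_ erefl).
  by rewrite !gE !evE (gC Hg Y X) gE0// gE0//; lra.
have deta0 X Y : ext_deriv eta X Y p = 0.
  rewrite (contact_deta Hc) -[X](subrK (eta X *: xi)) gDl// gZl// (gC Hg xi).
  rewrite metric_xi eta_phi mulr0 addr0; apply: gEF0; last exact: eta_phi.
  by rewrite linearB linearZ /= eta_xi mulr1 subrr.
have [Xs /negP[]] := contact_nondeg Hc p; rewrite /contact_volume ev_sum big1// => s _.
rewrite big_ord1 !evM [X in _ * (_ * X)](_ : _ = 0) ?mulr0//; exact: deta0.
Qed.

End ContactThreeManifold.



(** * The case R(X,Y) xi = 0 *)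

Section NullityZero.
Context {R : realType} {M : manifold R 3}.
Variables (eta : {scalar vfield M}) (xi : vfield M)
  (g : vfield M -> vfield M -> Cinfty M)
  (phi : {linear vfield M -> vfield M})
  (nabla : vfield M -> vfield M -> vfield M).
Hypotheses (Hc : contact_metric (n := 1) eta xi g phi) (Hn : levi_civita g nabla).
Hypothesis Rxi : forall X Y, curvature nabla X Y xi = 0.
Implicit Types (X Y Z W U V E : vfield M) (f h : Cinfty M) (p q : M).

Let Hg : riemannian_metric g := contact_riemannian Hc.
Let gE := (gDl Hg, gZl Hg, gNl Hg, gDr Hg, gZr Hg, gNr Hg, g0l Hg, g0r Hg).

Lemma nabla_nabla_xi X Y :
  nabla X (nabla Y xi) = nabla Y (nabla X xi) + nabla (bracket X Y) xi.
Proof.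
by have /eqP := Rxi X Y; rewrite /curvature -addrA -opprD subr_eq0 => /eqP.
Qed.

(** With [B Z = nabla Z xi], this is R(xi,Z) xi = 0 in the form that the covariant derivative of [B]
    along [xi] is [- B ^ 2]. *)
Lemma nabla_xi_nabla_xi Z :
  nabla xi (nabla Z xi) = nabla (nabla xi Z) xi - nabla (nabla Z xi) xi.
Proof.
rewrite nabla_nabla_xi (nabla_xi_xi Hc Hn) (nabla0r Hn) add0r.
by rewrite (bracketE Hn) (nablaDl Hn) (nablaNl Hn).
Qed.

(** * The operator B in the frame: trace zero and B^2 = 0 *)

Section Frame.
Variable E : vfield M.
Hypothesis etaE : eta E = 0.
Local Notation F := (phi E).
Local Notation rho := (g E E).
(** Up to the factor [rho], [a], [b], [c], [d] are the matrix entries of [B] on the kernel of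
    [eta]. *)
Local Notation a := (g (nabla E xi) E).
Local Notation b := (g (nabla E xi) F).
Local Notation c := (g (nabla F xi) E).
Local Notation d := (g (nabla F xi) F).

Lemma frame_skew q : b q = c q - 2 * rho q.
Proof.
have := congr1 (fun h : Cinfty M => h q) (nabla_xi_skew Hc Hn E F).
by rewrite (contact_phi2 Hc) etaE !gE !evE; lra.
Qed.

Lemma frame_derivative X q :
  [/\ (X rho : Cinfty M) q = 2 * g (nabla X E) E q,
      g (nabla X F) F q = g (nabla X E) E q &
      g (nabla X F) E q = - g (nabla X E) F q].
Proof.
have := congr1 (fun h : Cinfty M => h q) (derive_metric Hn X E E).
have := congr1 (fun h : Cinfty M => h q) (derive_metric Hn X F F).
have := congr1 (fun h : Cinfty M => h q) (derive_metric Hn X E F).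
rewrite (frame_orth Hc) (frame_norm Hc etaE) vf0 (gC Hg F (nabla X F)).
rewrite (gC Hg E (nabla X E)) (gC Hg E (nabla X F)).
by rewrite !evE => h1 h2 h3; split; lra.
Qed.

(** Derivatives along [xi] of the matrix entries of [B], from [nabla_xi_nabla_xi] expanded in the
    frame; the values of [B] have no [xi] component. *)
Lemma frame_evolution Z W q : eta W = 0 -> rho q != 0 ->
  rho q * (xi (g (nabla Z xi) W) : Cinfty M) q =
  (g (nabla xi Z) E q - g (nabla Z xi) E q) * g (nabla E xi) W q +
  (g (nabla xi Z) F q - g (nabla Z xi) F q) * g (nabla F xi) W q +
  (g (nabla Z xi) E q * g (nabla xi W) E q + g (nabla Z xi) F q * g (nabla xi W) F q).
Proof.
move=> etaW rq; rewrite (derive_metric Hn) nabla_xi_nabla_xi !gE !evE mulrDr mulrBr.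
rewrite (frame_metric Hc etaE (nabla Z xi) (nabla xi W) rq).
rewrite !(frame_nabla_xi Hc Hn etaE _ _ rq) (eta_nabla_xi Hc Hn) ev0; ring.
Qed.

(* Skew part of nabla_xi B = - B ^ 2, as b - c = - 2 rho has a known derivative. *)
Lemma frame_trace : vanishes_off_zeros rho (a + d).
Proof.
move=> q rq; have [r1 r2 r3] := frame_derivative xi q.
have eb := frame_evolution E (eta_phi Hc E) rq.
have ec := frame_evolution F etaE rq.
have ebc : b - c = cstC M (- 2) * rho.
  by apply: Cinfty_ext => p; rewrite !evE frame_skew; ring.
have := congr1 (fun h => (xi h : Cinfty M) q) ebc.
rewrite vfB vf_cstM !evE r1 => exi.
have bc := frame_skew q.
apply: (mulfI rq); rewrite mulr0.
have : rho q * (xi b : Cinfty M) q - rho q * (xi c : Cinfty M) q = - 4 * rho q * g (nabla xi E) E q.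
  by rewrite -mulrBr exi; ring.
(* The evolution equations give [- 4 * rho * g (nabla xi E) E + 2 * rho * (a + d)] for the same
   difference, so the last term is zero. *)
rewrite eb ec r2 r3 bc; lra.
Qed.

(* Trace of nabla_xi B = - B ^ 2, now that the trace of B is zero. *)
Lemma frame_nilpotent q : rho q != 0 -> a q * a q + b q * c q = 0.
Proof.
move=> rq; have [r1 r2 r3] := frame_derivative xi q.
have ea := frame_evolution E etaE rq.
have ed := frame_evolution F (eta_phi Hc E) rq.
have := vanishes_off_zeros_deriv xi frame_trace rq.
have /eqP := frame_trace rq; rewrite evD addr_eq0 => /eqP ad.
rewrite vfD evD => /(congr1 ( *%R (rho q))); rewrite mulr0 mulrDr ea ed r2 r3 ad; lra.
Qed.

(** Cayley-Hamilton for a 2 by 2 matrix: [frame_trace] and [frame_nilpotent] say that trace and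
    determinant vanish. *)
Lemma frame_nabla_xi_square Z q : rho q != 0 ->
  let BBZ := nabla (nabla Z xi) xi in g BBZ BBZ q = 0.
Proof.
move=> rq BBZ; have nil := frame_nilpotent rq.
have /eqP := frame_trace rq; rewrite evD addr_eq0 => /eqP ad.
have BB Y := frame_nabla_xi Hc Hn etaE (nabla Z xi) Y rq.
have hx := frame_nabla_xi Hc Hn etaE Z E rq.
have hy := frame_nabla_xi Hc Hn etaE Z F rq.
set x := g (nabla Z xi) E q in hx BB; set y := g (nabla Z xi) F q in hy BB.
have BBE : g BBZ E q = 0.
  (* Two applications of [B] are expanded in the frame, and each costs a factor [rho q]. *)
  apply/(mulfI rq)/(mulfI rq); rewrite !mulr0 BB.
  transitivity (a q * (rho q * x) + c q * (rho q * y)); first ring.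
  rewrite hx hy.
  transitivity (g Z E q * (a q * a q + b q * c q) + g Z F q * c q * (a q + d q)); first ring.
  by rewrite nil ad; ring.
have BBF : g BBZ F q = 0.
  apply/(mulfI rq)/(mulfI rq); rewrite !mulr0 BB.
  transitivity (b q * (rho q * x) + d q * (rho q * y)); first ring.
  rewrite hx hy.
  transitivity (g Z F q * (a q * a q + b q * c q) + (g Z E q * b q + g Z F q * (d q - a q)) * (a q + d q)).
    ring.
  by rewrite nil ad; ring.
apply: (mulfI rq); rewrite (frame_metric Hc etaE _ _ rq) BBE BBF (eta_nabla_xi Hc Hn) ev0.
by ring.
Qed.

End Frame.

Lemma nabla_xi_square Z : nabla (nabla Z xi) xi = 0.
Proof.
apply: (metric_definite Hg) => p; have [E etaE rp] := horizontal_exists Hc p.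
exact: frame_nabla_xi_square rp.
Qed.

(** As [B ^ 2 = 0], both [B E] and [B (phi E)] lie in the kernel of [B]. They cannot both vanish at
    [p], since [b - c = - 2 * rho] there. *)
Lemma parallel_direction p : exists E, [/\ eta E = 0, nabla E xi = 0 & g E E p != 0].
Proof.
have [E etaE rp] := horizontal_exists Hc p.
have bc := frame_skew etaE p.
have sq W := frame_metric Hc etaE (nabla W xi) (nabla W xi) rp.
have [BE0|BE] := eqVneq (g (nabla E xi) (nabla E xi) p) 0; last first.
  exists (nabla E xi); split=> //; [exact: (eta_nabla_xi Hc Hn) | exact: nabla_xi_square].
have [BF0|BF] := eqVneq (g (nabla (phi E) xi) (nabla (phi E) xi) p) 0; last first.
  exists (nabla (phi E) xi); split=> //; [exact: (eta_nabla_xi Hc Hn) | exact: nabla_xi_square].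
have := sq E; have := sq (phi E); rewrite BE0 BF0 !(eta_nabla_xi Hc Hn) ev0 !mulr0 !add0r -!expr2.
move=> /esym/eqP; rewrite paddr_eq0 ?sqr_ge0// !sqrf_eq0 => /andP[/eqP c0 _].
move=> /esym/eqP; rewrite paddr_eq0 ?sqr_ge0// !sqrf_eq0 => /andP[_ /eqP b0].
by move: bc rp; rewrite b0 c0 sub0r => /esym/eqP; rewrite oppr_eq0 mulf_eq0 pnatr_eq0/= => ->.
Qed.

(** * A frame with [nabla E xi = 0], and vanishing of the curvature *)

Section ParallelFrame.
Variable E : vfield M.
Hypotheses (etaE : eta E = 0) (BE : nabla E xi = 0).
Local Notation F := (phi E).
Local Notation rho := (g E E).
(** Up to the factor [rho], the connection form relating [E] and [F]. *)
Local Notation T := (fun Z => g (nabla Z E) F).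

(** Here [a = b = 0], so [frame_skew] gives [c = 2 * rho]. *)
Lemma parallel_nabla_xi_E Z q : rho q != 0 -> g (nabla Z xi) E q = 2 * g Z F q.
Proof.
move=> rq; apply: (mulfI rq); rewrite (frame_nabla_xi Hc Hn etaE _ _ rq) BE !gE ev0.
by have := frame_skew etaE q; rewrite BE !gE ev0 => h; rewrite mulr0 add0r; nra.
Qed.

Lemma parallel_nabla_xi_F Z q : rho q != 0 -> g (nabla Z xi) F q = 0.
Proof.
move=> rq; apply: (mulfI rq); rewrite (frame_nabla_xi Hc Hn etaE _ _ rq) BE !gE ev0.
have /eqP := frame_trace etaE rq; rewrite BE !gE evD ev0 add0r => /eqP ->.
by rewrite !mulr0 addr0.
Qed.

(** R(xi,E) xi = 0 reduces to [B (nabla xi E) = 0], whose [E] component is [2 * T xi]. *)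
Lemma twist_xi : vanishes_off_zeros rho (T xi).
Proof.
move=> q rq; have := nabla_xi_nabla_xi E; rewrite BE (nabla0r Hn) (nabla0l Hn) subr0.
move=> /(congr1 (fun X => g X E q)); rewrite gE ev0 parallel_nabla_xi_E// => /esym/eqP.
by rewrite mulf_eq0 pnatr_eq0/= => /eqP.
Qed.

(** R(E,F) xi = 0 reads [nabla E (B F) = B (bracket E F)]; its [F] component yields [T E = 0] and
    its [E] component [T F = 0]. *)
Lemma twist_E_F : vanishes_off_zeros rho (T E) /\ vanishes_off_zeros rho (T F).
Proof.
have := nabla_nabla_xi E F; rewrite BE (nabla0r Hn) add0r => comm.
have rhoF : vanishes_off_zeros rho (g (nabla F xi) F).
  by move=> q; exact: parallel_nabla_xi_F.
have rhoE : vanishes_off_zeros rho (g (nabla F xi) E - cstC M 2 * rho).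
  by move=> q rq; rewrite !evE parallel_nabla_xi_E// (frame_norm Hc etaE); ring.
split=> q rq.
(* Differentiate [g (B F) F = 0] along [E]. *)
- have := congr1 (fun h : Cinfty M => h q) (derive_metric Hn E (nabla F xi) F).
  rewrite comm (vanishes_off_zeros_deriv E rhoF rq) evD parallel_nabla_xi_F// add0r.
  have [_ _ r3] := frame_derivative etaE E q.
  have := frame_metric Hc etaE (nabla F xi) (nabla E F) rq.
  rewrite (eta_nabla_xi Hc Hn) ev0 parallel_nabla_xi_E// parallel_nabla_xi_F// r3 (frame_norm Hc etaE).
  by move=> h1 h2; apply: (mulfI rq); rewrite -h2 in h1; lra.
(* Differentiate [g (B F) E = 2 * rho] along [E]. *)
- have := congr1 (fun h : Cinfty M => h q) (derive_metric Hn E (nabla F xi) E).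
  have := vanishes_off_zeros_deriv E rhoE rq.
  rewrite vfB vf_cstM comm !evE parallel_nabla_xi_E// => /eqP; rewrite subr_eq0 => /eqP ->.
  have [r1 _ _] := frame_derivative etaE E q.
  have [_ r2 _] := frame_derivative etaE E q.
  have := frame_metric Hc etaE (nabla F xi) (nabla E E) rq.
  rewrite (eta_nabla_xi Hc Hn) ev0 parallel_nabla_xi_E// parallel_nabla_xi_F// (frame_norm Hc etaE) r1.
  rewrite (bracketE Hn) gE gE !evE r2 => h1 h2.
  apply: (mulfI rq); rewrite mulr0; move: h1 h2; nra.
Qed.

Lemma twist_vanishes Z : vanishes_off_zeros rho (T Z).
Proof.
move=> q rq; have [TE TF] := twist_E_F; apply: (mulfI rq).
rewrite (@frame_linear _ _ _ _ _ _ Hc _ etaE T q Z)// => [|f X Y].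
  by rewrite twist_xi// TE// TF// !mulr0 !addr0.
by rewrite (nablaDl Hn) (nablaZl Hn) !gE.
Qed.

(** Differentiating [T V = 0] along [U] leaves [- g (nabla V E) (nabla U F)]. In the frame its [E]
    and [F] terms contain [T U] or [T V], and its [xi] term contains
    [eta (nabla U F) = - g F (nabla U xi) = 0]. *)
Lemma nabla_nabla_twist U V q : rho q != 0 -> g (nabla U (nabla V E)) F q = 0.
Proof.
move=> rq; have := congr1 (fun h : Cinfty M => h q) (derive_metric Hn U (nabla V E) F).
rewrite (vanishes_off_zeros_deriv U (twist_vanishes V) rq) evD => /esym/eqP.
rewrite addr_eq0 => /eqP ->; apply: (mulfI rq).
have [_ _ UF] := frame_derivative etaE U q.
rewrite mulrN (frame_metric Hc etaE _ _ rq) UF twist_vanishes// twist_vanishes//.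
have -> : eta (nabla U F) q = 0.
  have := congr1 (fun h : Cinfty M => h q) (derive_metric Hn U F xi).
  rewrite (metric_xi Hc) (eta_phi Hc) vf0 (metric_xi Hc) (gC Hg F) evD ev0.
  by rewrite parallel_nabla_xi_F// addr0.
by ring.
Qed.

Lemma curvature_twist U V q : rho q != 0 -> g (curvature nabla U V E) F q = 0.
Proof.
move=> rq; rewrite /curvature !gE !evE !nabla_nabla_twist//.
by rewrite twist_vanishes// !subr0.
Qed.

(** The curvature operator of [U], [V] is skew and kills [xi], so its only possible entry in the
    frame is the one between [E] and [F], which is zero by [curvature_twist]. *)
Lemma parallel_frame_flat U V X Y q : rho q != 0 -> g (curvature nabla U V X) Y q = 0.
Proof.
move=> rq; have skew := curvature_skew Hg Hn U V.
have Rxi0 Z : g (curvature nabla U V Z) xi = 0 by rewrite skew Rxi gE oppr0.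
have diag Z : g (curvature nabla U V Z) Z q = 0.
  by have := congr1 (fun h : Cinfty M => h q) (skew Z Z); rewrite (gC Hg Z) evN; lra.
have FE : g (curvature nabla U V F) E q = 0.
  by rewrite skew (gC Hg) evN curvature_twist// oppr0.
have row Z : g (curvature nabla U V Z) E q = 0 ->
    g (curvature nabla U V Z) F q = 0 -> g (curvature nabla U V Z) Y q = 0.
  move=> ZE ZF; apply: (mulfI rq); rewrite (frame_metric Hc etaE _ _ rq) ZE ZF.
  by rewrite -(metric_xi Hc) Rxi0 ev0; ring.
have rowE := row E (diag E) (curvature_twist U V rq).
have rowF := row F FE (diag F).
apply: (mulfI rq).
rewrite (@frame_linear _ _ _ _ _ _ Hc _ etaE (fun X => g (curvature nabla U V X) Y) q X)//.
  by rewrite Rxi (g0l Hg) ev0 rowE rowF; ring.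
by move=> f Z W; rewrite (curvatureDr Hn) (curvatureZr Hn) !gE.
Qed.

End ParallelFrame.

Lemma nullity_zero_flat : flat nabla.
Proof.
move=> U V X; apply: (metric_definite Hg) => p.
have [E [etaE BE Ep]] := parallel_direction p.
exact: (parallel_frame_flat etaE BE).
Qed.

End NullityZero.

(** * Recurrence forces k = 0, and flatness implies recurrence *)

Lemma phi_recurrent_nullity_eq0 (R : realType) (M : manifold R 3) (k : R)
    (eta : {scalar vfield M}) (xi : vfield M)
    (g : vfield M -> vfield M -> Cinfty M)
    (phi : {linear vfield M -> vfield M})
    (nabla : vfield M -> vfield M -> vfield M) :
  contact_metric (n := 1) eta xi g phi -> levi_civita g nabla ->
  N_contact k eta xi nabla -> phi_recurrent phi nabla -> k = 0.
Proof.
move=> Hc Hn Nk [A [W AW0] Arec]; have Hg := contact_riemannian Hc.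
have [p AWp] : exists p, A W p != 0.
  apply: contrapT => nA; apply: AW0; apply: Cinfty_ext => p.
  by apply/eqP/negP => /negP Ap; apply: nA; exists p.
have [E etaE Ep] := horizontal_exists Hc p.
(* For these arguments [eta (curvature nabla E xi E)] equals [- k * g E E], which is non-zero at [p]
   unless [k = 0]. *)
have := congr1 eta (Arec W E xi E); rewrite (eta_phi Hc) linearZ /= -(metric_xi Hc).
rewrite (curvature_skew Hg Hn) Nk (gZr Hg) (gDr Hg) (gNr Hg) !(gZr Hg).
rewrite !(metric_xi Hc) (eta_xi Hc) etaE => /(congr1 (fun h : Cinfty M => h p)).
rewrite !evE mul1r mul0r subr0 => /esym/eqP.
by rewrite !(mulf_eq0, oppr_eq0) (negbTE AWp) (negbTE Ep) orbF => /eqP.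
Qed.

Lemma flat_nullity_recurrent (R : realType) (M : manifold R 3)
    (eta : {scalar vfield M}) (xi : vfield M)
    (g : vfield M -> vfield M -> Cinfty M)
    (phi : {linear vfield M -> vfield M})
    (nabla : vfield M -> vfield M -> vfield M) :
  contact_metric (n := 1) eta xi g phi -> levi_civita g nabla -> flat nabla ->
  N_contact 0 eta xi nabla /\ phi_recurrent phi nabla.
Proof.
move=> Hc Hn fl; split=> [X Y|]; first by rewrite fl cstC0 scale0r.
exists eta; last first.
  by move=> W X Y Z; rewrite /nabla_curvature !fl (nabla0r Hn) !subr0 !linear0.
(* That 1 differs from 0 among smooth functions is the non-emptiness of the manifold. *)
exists xi; rewrite (eta_xi Hc) => one0; have [p] := manifold_nonempty M.
by have /eqP := congr1 (fun h : Cinfty M => h p) one0; rewrite ev1 ev0 oner_eq0.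
Qed.

Theorem theorem3p5 (R : realType) (M : manifold R 3)
  (eta : {scalar vfield M}) (xi : vfield M)
  (g : vfield M -> vfield M -> Cinfty M)
  (phi : {linear vfield M -> vfield M})
  (nabla : vfield M -> vfield M -> vfield M) :
  contact_metric (n := 1) eta xi g phi ->
  levi_civita g nabla ->
  ((exists k : R, N_contact k eta xi nabla /\
                  phi_recurrent phi nabla)
   <-> flat nabla).
Proof.
move=> Hc Hn; split=> [[k [Nk rec]]|fl]; last by exists 0; exact: flat_nullity_recurrent Hc Hn fl.
have k0 := phi_recurrent_nullity_eq0 Hc Hn Nk rec.
by apply: (nullity_zero_flat Hc Hn) => X Y; rewrite Nk k0 cstC0 scale0r.
Qed.
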